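(* Let $(A,\rho_A,[\cdot,\cdot]_A)$ be a Lie algebroid over a manifold $M$, $E$ a vector bundle over $M$, $\nabla:\Gamma(A)\to\mathscr{CDO}(E)$ an $\mathbb{R}$-linear connection of $A$ on $E$, and $\theta\in\mathcal{A}lt^1_{\mathbb{R}}(\Gamma(A);\Gamma(\mathrm{End}\,E))$. Then $\nabla+\theta$ is an $\mathbb{R}$-linear connection of $A$ on $E$, $$\mathrm{cs}_1(\nabla,\nabla+\theta)(a)=\mathrm{tr}(\theta(a)),\qquad a\in\Gamma(A),$$ and $$\mathrm{cs}_2(\nabla,\nabla+\theta)=\mathrm{tr}\Bigl(2\,\theta\wedge R^\nabla+\theta\wedge d^{\overline\nabla}_{\mathbb{R}}\theta+\tfrac23\,\theta\wedge\theta\wedge\theta\Bigr).$$ If $\nabla$ and $\nabla+\theta$ are both flat, then $$\mathrm{cs}_2(\nabla,\nabla+\theta)=-\tfrac13\,\mathrm{tr}(\theta\wedge\theta\wedge\theta).$$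
   Context: All manifolds, bundles and sections are smooth; vector bundles are real. A Lie algebroid $(A,\rho_A,[\cdot,\cdot]_A)$ over $M$ is a vector bundle $A\to M$ with a vector bundle homomorphism $\rho_A:A\to TM$ (the anchor) and a real Lie algebra structure $[\cdot,\cdot]_A$ on $\Gamma(A)$ satisfying $[a,fb]_A=f[a,b]_A+\rho_A(a)(f)\,b$ for $a,b\in\Gamma(A)$, $f\in C^\infty(M)$. $\mathscr{CDO}(E)$ is the space of covariant differential operators of $E$: $\mathbb{R}$-linear $\ell:\Gamma(E)\to\Gamma(E)$ for which there is exactly one vector field $\tilde\ell\in\mathfrak{X}(M)$ with $\ell(f\zeta)=f\ell(\zeta)+\tilde\ell(f)\zeta$ for all $f\in C^\infty(M)$, $\zeta\in\Gamma(E)$. An $\mathbb{R}$-linear connection of $A$ on $E$ is an $\mathbb{R}$-linear (not necessarily $C^\infty(M)$-linear, nor local) map $\nabla:\Gamma(A)\to\mathscr{CDO}(E)$, $a\mapsto\nabla_a$, with $\widetilde{\nabla_a}=\rho_A\circ a$. Its curvature is $R^\nabla_{a,b}=\nabla_a\nabla_b-\nabla_b\nabla_a-\nabla_{[a,b]_A}\in\Gamma(\mathrm{End}\,E)$; $\nabla$ is flat if $R^\nabla=0$. $\mathcal{A}lt^n_{\mathbb{R}}(\Gamma(A);V)$, for $V=C^\infty(M)$ or $V=\Gamma(\mathrm{End}\,E)$, is the space of $\mathbb{R}$-multilinear antisymmetric maps $\Gamma(A)^n\to V$. The connection $\overline\nabla$ of $A$ on $\mathrm{End}\,E$ is $\overline\nabla_a=[\nabla_a,\cdot\,]$,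 and for a $1$-form $\theta$, $(d^{\overline\nabla}_{\mathbb{R}}\theta)(a,b)=[\nabla_a,\theta(b)]-[\nabla_b,\theta(a)]-\theta([a,b]_A)$. Wedge products of $\mathrm{End}\,E$-valued forms use composition of endomorphisms and the standard normalization $(\omega\wedge\eta)(a_1,\dots,a_{m+n})=\frac1{m!\,n!}\sum_{\tau\in S_{m+n}}\mathrm{sgn}\,\tau\;\omega(a_{\tau(1)},\dots,a_{\tau(m)})\circ\eta(a_{\tau(m+1)},\dots,a_{\tau(m+n)})$; $\mathrm{tr}$ of such a form is the fibrewise trace of its values. For $p\ge1$, and an $\mathbb{R}$-linear connection $\nabla$ of a Lie algebroid on a vector bundle, $\mathrm{ch}_p(\nabla)=\mathrm{tr}\,(R^\nabla)^p$, where $$(R^\nabla)^p(a_1,\dots,a_{2p})=\frac1{2^p}\sum_{\tau\in S_{2p}}\mathrm{sgn}\,\tau\; R^\nabla_{a_{\tau(1)},a_{\tau(2)}}\circ\cdots\circ R^\nabla_{a_{\tau(2p-1)},a_{\tau(2p)}}.$$ For $\mathbb{R}$-linear connections $\nabla^0,\nabla^1$ of $A$ on $E$, let $\mathrm{pr}_2:\mathbb{R}\times M\to M$ be the projection and $T\mathbb{R}\times A$ the product Lie algebroid over $\mathbb{R}\times M$; write $a$ for the section $0\times a$ and $\partial/\partial t$ for $\frac{\partial}{\partial t}\times0$. The affine combination $\nabla^{\mathrm{aff}_1}$ is the $\mathbb{R}$-linear connection of $T\mathbb{R}\times A$ on $\mathrm{pr}_2^*E$ with $\nabla^{\mathrm{aff}_1}_{\partial/\partial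 t}(\nu\circ\mathrm{pr}_2)=0$ and $\nabla^{\mathrm{aff}_1}_a(\nu\circ\mathrm{pr}_2)(t,\cdot)=(1-t)\nabla^0_a\nu+t\nabla^1_a\nu$ for $\nu\in\Gamma(E)$, $a\in\Gamma(A)$ (extended to all sections of $\mathrm{pr}_2^*E$ by the Leibniz rule; only these operators, and the brackets $[\partial/\partial t,a]=0$, $[a,b]=[a,b]_A$, are needed below). The Chern–Simons form $\mathrm{cs}_p(\nabla^0,\nabla^1)\in\mathcal{A}lt^{2p-1}_{\mathbb{R}}(\Gamma(A);C^\infty(M))$ is $$\mathrm{cs}_p(\nabla^0,\nabla^1)(a_1,\dots,a_{2p-1})=\int_0^1\mathrm{ch}_p(\nabla^{\mathrm{aff}_1})\Bigl(\frac{\partial}{\partial t},a_1,\dots,a_{2p-1}\Bigr)\Big|_{(t,\cdot)}dt.$$ *)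

(* Defs.v *)
From HB Require Import structures.
From mathcomp Require Import all_boot all_order all_algebra all_fingroup.
From mathcomp Require Import all_classical all_reals all_analysis.

Set Implicit Arguments.
Unset Strict Implicit.
Unset Printing Implicit Defensive.
Import Order.TTheory GRing.Theory Num.Theory.
Import numFieldNormedType.Exports.

Local Open Scope classical_set_scope.
Local Open Scope ring_scope.

(* C^k and C^oo on an open subset U of a finite-dimensional normed space V:
   C^(k+1) means differentiable with all directional derivatives of class C^k.
   The values outside of U are irrelevant. *)
Fixpoint Ck_on (R : realType) (V W : normedModType R) (k : nat)
    (U : set V) (f : V -> W) : Prop :=
  if k is k'.+1 then
    (forall x, U x -> differentiable f x) /\
    (forall v, Ck_on k' U (fun x => 'D_v f x))
  else forall x, U x -> {for x, continuous f}.

Definition smooth_on (R : realType) (V W : normedModType R)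
    (U : set V) (f : V -> W) : Prop :=
  forall k, Ck_on k U f.

Lemma near_eq_differentiable (R : realType) (V W : normedModType R)
    (f g : V -> W) (x : V) :
  {near x, f =1 g} -> differentiable f x -> differentiable g x.
Proof.
move=> fg df; have [dfc fE] := (diff_locallyP x f).1 df.
have gE : g \o shift x = cst (g x) + 'd f x +o_ 0 id.
  have fgx : f x = g x by exact: nbhs_singleton fg.
  apply/eqaddoP => e e0; have /eqaddoP/(_ e e0) := fE.
  have : \forall y \near (0 : V), f (y + x) = g (y + x).
    by move: fg; rewrite {1}(near_shift 0 x) subr0.
  by apply: filterS2 => y /= fgy; rewrite !fctE /= fgx fgy.
by apply/diff_locallyP; rewrite (diff_unique dfc gE).
Qed.

Lemma Ck_on_ext (R : realType) (V W : normedModType R) k (U : set V)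
    (f g : V -> W) :
  open U -> {in U, f =1 g} -> Ck_on k U f -> Ck_on k U g.
Proof.
move=> oU; elim: k f g => [|k IH] f g fg.
  move=> cf x Ux; have near_fg : {near x, f =1 g}.
    by apply: filterS (open_nbhs_nbhs (conj oU Ux)) => y Uy; apply/fg/mem_set.
  change (g @ x --> g x); rewrite -(fg x (mem_set Ux)).
  by apply: cvg_trans (cf x Ux); exact: near_eq_cvg.
move=> [df dDf]; split=> [x Ux|v].
  apply: near_eq_differentiable (df x Ux).
  by apply: filterS (open_nbhs_nbhs (conj oU Ux)) => y Uy; apply/fg/mem_set.
apply: IH (dDf v) => x /set_mem Ux; apply: near_eq_derive.
by apply: filterS (open_nbhs_nbhs (conj oU Ux)) => y Uy; apply/fg/mem_set.
Qed.

Lemma smooth_on_cst (R : realType) (V W : normedModType R) (U : set V) (c : W) :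
  smooth_on U (fun=> c).
Proof.
move=> k; elim: k c => [|k IH] c /=; first by move=> x _; exact: cvg_cst.
split=> [x _|v]; first exact: differentiable_cst.
have -> : (fun x => 'D_v (fun=> c) x) = fun=> (0 : W).
  by apply/funext => x; exact: derive_cst.
exact: IH.
Qed.

Lemma smooth_on_linear (R : realType) (V W : normedModType R) (U : set V)
    (f : {linear V -> W}) :
  continuous f -> smooth_on U f.
Proof.
move=> cf [|k] /=; first by move=> x _; exact: cf.
split=> [x _|v]; first exact: linear_differentiable.
have -> : (fun x => 'D_v f x) = fun=> f v.
  apply/funext => x; rewrite deriveE; last exact: linear_differentiable.
  by rewrite diff_lin.
exact: smooth_on_cst.
Qed.

Lemma smooth_on_pair (R : realType) (V W1 W2 : normedModType R) (U : set V)
    (f : V -> W1) (g : V -> W2) :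
  open U -> smooth_on U f -> smooth_on U g -> smooth_on U (fun x => (f x, g x)).
Proof.
move=> oU sf sg k; have := sg k; have := sf k; clear sf sg.
elim: k f g => [|k IH] f g /=.
  by move=> cf cg x Ux; apply: cvg_pair; [exact: cf|exact: cg].
move=> [df Df] [dg Dg]; split=> [x Ux|v].
  by apply: differentiable_pair; [exact: df|exact: dg].
apply: Ck_on_ext (IH _ _ (Df v) (Dg v)) => // x /set_mem Ux.
rewrite !deriveE ?diff_pair//; try by [exact: df|exact: dg].
by apply: differentiable_pair; [exact: df|exact: dg].
Qed.

Lemma smooth_on_snd (R : realType) (V1 V2 W : normedModType R) (U : set V2)
    (f : V2 -> W) :
  smooth_on U f -> smooth_on [set p : V1 * V2 | U p.2] (fun p => f p.2).
Proof.
move=> sf k; have := sf k; clear sf.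
elim: k f => [|k IH] f /=.
  by move=> cf p Up; apply: (@cvg_comp _ _ _ snd f); [exact: cvg_snd|exact: cf].
move=> [df Df]; split=> [p Up|v].
  apply: (@differentiable_comp _ _ _ _ snd f); last exact: df.
  by apply: linear_differentiable => q; exact: cvg_snd.
exact: IH (Df v.2).
Qed.

(* A smooth manifold modelled on V (used with V = R^n and, for products with
   the line, V = R * R^n). The charts are total functions that only matter on
   their domains; chart_inj, chart_cont and chart_open say that each of them is
   a homeomorphism of its domain onto an open subset of V. *)
Record manifold (R : realType) (V : normedModType R) := Manifold {
  mpoint :> topologicalType;
  manifold_hausdorff : hausdorff_space mpoint;
  manifold_countable : @second_countable mpoint;
  chart_idx : Type;
  chart_dom : chart_idx -> set mpoint;
  chart : chart_idx -> mpoint -> V;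
  chart_dom_open : forall i, open (chart_dom i);
  chart_cover : forall x, exists i, chart_dom i x;
  chart_inj : forall i, set_inj (chart_dom i) (chart i);
  chart_cont : forall i x, chart_dom i x -> {for x, continuous (chart i)};
  chart_open : forall i (U : set mpoint),
    open U -> U `<=` chart_dom i -> open (chart i @` U);
  chart_smooth : forall i j, exists2 g : V -> V,
    smooth_on (chart i @` (chart_dom i `&` chart_dom j)) g &
    forall x, chart_dom i x -> chart_dom j x -> chart j x = g (chart i x) }.

Lemma hausdorff_prod (S T : topologicalType) :
  hausdorff_space S -> hausdorff_space T -> hausdorff_space (S * T)%type.
Proof.
move=> hS hT [s t] [s' t'] cl; congr (_, _).
  apply: hS => A B nA nB.
  have [] := cl (A `*` setT) (B `*` setT).
  - by exists (A, setT) => //; split => //; exact: filterT.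
  - by exists (B, setT) => //; split => //; exact: filterT.
  by move=> [x y] [[/= Ax _] [/= Bx _]]; exists x.
apply: hT => A B nA nB.
have [] := cl (setT `*` A) (setT `*` B).
- by exists (setT, A) => //; split => //; exact: filterT.
- by exists (setT, B) => //; split => //; exact: filterT.
by move=> [x y] [[/= _ Ay] [/= _ By]]; exists y.
Qed.

Lemma open_prod (S T : topologicalType) (A : set S) (B : set T) :
  open A -> open B -> open (A `*` B).
Proof.
rewrite !openE => oA oB [s t] [/= As Bt].
by exists (A, B) => //; split; [exact: oA|exact: oB].
Qed.

Lemma second_countable_prod (S T : topologicalType) :
  @second_countable S -> @second_countable T ->
  @second_countable (S * T)%type.
Proof.
move=> [BS cS [oS bS]] [BT cT [oT bT]].
exists ((fun p => p.1 `*` p.2) @` (BS `*` BT)).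
  apply: sub_countable (card_image_le _ _) _; exact: countableX.
split=> [_ [[A B] [/= /oS oA /oT oB] <-]|[s t] W [[A B] [/= nA nB] sW]].
  exact: open_prod.
have [A' [BA' A's] sA'] := bS s A nA.
have [B' [BB' B't] sB'] := bT t B nB.
exists (A' `*` B') => /=.
  by split; [exists (A', B')|split].
by move=> [x y] [/= A'x B'y]; apply: sW; split; [exact: sA'|exact: sB'].
Qed.

Lemma second_countable_line (R : realType) : @second_countable R.
Proof.
pose I (q : rat * rat) : set R := [set x | ratr q.1 < x < ratr q.2].
exists (range I).
  by apply: sub_countable (card_image_le _ _) _; exact: countableP.
split=> [_ [q _ <-]|x W /nbhs_ballP[e /= e0 sW]].
  suff -> : I q = [set` `]ratr q.1, ratr q.2[] by exact: interval_open.
  by apply/seteqP; split=> y; rewrite /I /= in_itv.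
have [p _ px] : exists2 p : rat, True & x - e < ratr p < x.
  have [p] : exists p : rat, ratr p \in `](x - e), x[.
    by apply: rat_in_itvoo; rewrite ltrBlDr ltrDl.
  by rewrite in_itv => ?; exists p.
have [q _ qx] : exists2 q : rat, True & x < ratr q < x + e.
  have [q] : exists q : rat, ratr q \in `]x, (x + e)[.
    by apply: rat_in_itvoo; rewrite ltrDl.
  by rewrite in_itv => ?; exists q.
move: px qx => /andP[p1 p2] /andP[q1 q2].
exists (I (p, q)); first by split; [exists (p, q)|rewrite /I /= p2 q1].
move=> y; rewrite /I /= => /andP[py yq]; apply: sW.
rewrite /ball /= ltr_distlC; apply/andP; split.
  exact: lt_trans p1 py.
exact: lt_trans yq q2.
Qed.

Section line_product.
Context (R : realType) (V : normedModType R) (M : manifold V).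

Definition line_dom (i : chart_idx M) : set (R * M)%type :=
  [set p | chart_dom i p.2].

Definition line_chart (i : chart_idx M) (p : (R * M)%type) : (R * V)%type :=
  (p.1, chart i p.2).

Lemma line_dom_open i : open (line_dom i).
Proof.
have -> : line_dom i = setT `*` chart_dom i.
  by apply/seteqP; split=> p //= [].
by apply: open_prod; [exact: openT|exact: chart_dom_open].
Qed.

Lemma line_dom_cover (p : (R * M)%type) : exists i, line_dom i p.
Proof. by have [i ip] := chart_cover p.2; exists i. Qed.

Lemma line_chart_inj i : set_inj (line_dom i) (line_chart i).
Proof.
move=> [s x] [t y] /set_mem /= ix /set_mem /= iy [-> xy]; congr (_, _).
by apply: (@chart_inj _ _ M i); rewrite ?inE.
Qed.

Lemma line_chart_cont i p : line_dom i p -> {for p, continuous (line_chart i)}.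
Proof.
move=> ip.
have cs : (fun q : (R * M)%type => chart i q.2) @ p --> chart i p.2.
  by apply: (@cvg_comp _ _ _ snd (chart i)); [exact: cvg_snd|exact: chart_cont].
have cf : (fun q : (R * M)%type => q.1) @ p --> p.1 by exact: cvg_fst.
exact: (cvg_pair cf cs).
Qed.

Lemma line_chart_open i (U : set (R * M)%type) :
  open U -> U `<=` line_dom i -> open (line_chart i @` U).
Proof.
rewrite {1}openE => oU Ui; rewrite openE => _ [[t x] Utx <-].
have [[A B] [/= nA nB] sU] := oU _ Utx.
pose B' := interior B `&` chart_dom i.
exists (A, chart i @` B') => /=.
  split => //; apply: open_nbhs_nbhs; split.
    apply: chart_open; last by move=> y [].
    by apply: openI; [exact: open_interior|exact: chart_dom_open].
  by exists x => //; split; [exact: nB|exact: (Ui _ Utx)].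
move=> [s _] [/= As [y [By iy] <-]]; exists (s, y) => //.
by apply: sU; split => //; exact: interior_subset.
Qed.

Lemma line_chart_smooth i j : exists2 g : (R * V)%type -> (R * V)%type,
  smooth_on (line_chart i @` (line_dom i `&` line_dom j)) g &
  forall p, line_dom i p -> line_dom j p -> line_chart j p = g (line_chart i p).
Proof.
have [g sg gE] := chart_smooth i j.
exists (fun q => (q.1, g q.2)); last by move=> p ip jp; rewrite /line_chart gE.
have -> : line_chart i @` (line_dom i `&` line_dom j) =
    [set q | (chart i @` (chart_dom i `&` chart_dom j)) q.2].
  apply/seteqP; split=> [_ [p [ip jp] <-]|[t _] /= [x [ix jx] <-]].
    by exists p.2.
  by exists (t, x).
apply: smooth_on_pair.
- rewrite (_ : [set _ | _] =
      setT `*` (chart i @` (chart_dom i `&` chart_dom j))).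
    apply: open_prod; first exact: openT.
    by apply: chart_open; [apply: openI; exact: chart_dom_open|exact: subIsetl].
  by apply/seteqP; split=> q //= [].
- by apply: smooth_on_linear => q; exact: cvg_fst.
- exact: smooth_on_snd.
Qed.

(* The product manifold R * M. *)
Definition line_prod : manifold (R * V)%type :=
  @Manifold R (R * V)%type (R * M)%type
    (hausdorff_prod (@Rhausdorff R) (@manifold_hausdorff _ _ M))
    (second_countable_prod (second_countable_line R) (@manifold_countable _ _ M))
    (chart_idx M) line_dom line_chart line_dom_open line_dom_cover
    line_chart_inj line_chart_cont line_chart_open line_chart_smooth.

End line_product.

(* f is smooth on the open subset U of M: its local expressions are. *)
Definition smooth_fun_on (R : realType) (V : normedModType R) (M : manifold V)
    (U : set M) (f : M -> R) : Prop :=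
  forall i, exists2 g : V -> R,
    smooth_on (chart i @` (U `&` chart_dom i)) g &
    forall x, U x -> chart_dom i x -> f x = g (chart i x).

Definition Cinf (R : realType) (V : normedModType R) (M : manifold V) :
    set (M -> R) :=
  [set f | smooth_fun_on setT f].

(* A tangent vector at x, identified with the derivative of functions along it:
   in some chart around x, the directional derivative along some w in V. It is
   represented by a functional on all functions M -> R, of which only the
   values on C^oo(M) are meaningful. *)
Definition tangent (R : realType) (V : normedModType R) (M : manifold V)
    (x : M) (v : (M -> R) -> R) : Prop :=
  exists (i : chart_idx M) (w : V), chart_dom i x /\
    forall (f : M -> R) (g : V -> R), Cinf f ->
      smooth_on (chart i @` chart_dom i) g ->
      (forall y, chart_dom i y -> f y = g (chart i y)) ->
      v f = 'D_w g (chart i x).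

Definition vector_field (R : realType) (V : normedModType R) (M : manifold V)
    (X : M -> (M -> R) -> R) : Prop :=
  (forall x, tangent x (X x)) /\
  (forall f, Cinf f -> Cinf (fun x => X x f)).

(* Real vector bundles, with local trivializations given as local frames: over
   frame_dom i, frame i is a basis of each fibre, and the change of frame
   between i and j has smooth coefficients. The rank may depend on i, i.e. it
   is only locally constant. *)
Record vbundle (R : realType) (V : normedModType R) (M : manifold V) :=
  Vbundle {
  fibre :> M -> vectType R;
  frame_idx : Type;
  frame_rank : frame_idx -> nat;
  frame_dom : frame_idx -> set M;
  frame : forall (i : frame_idx) (x : M), (frame_rank i).-tuple (fibre x);
  frame_dom_open : forall i, open (frame_dom i);
  frame_cover : forall x, exists i, frame_dom i x;
  frame_basis : forall i x, frame_dom i x -> basis_of fullv (frame i x);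
  frame_smooth : forall i j (k : 'I_(frame_rank i)) (l : 'I_(frame_rank j)),
    smooth_fun_on (frame_dom i `&` frame_dom j)
      (fun x => coord (frame i x) k (tnth (frame j x) l)) }.

Section pullback.
Context (R : realType) (V : normedModType R) (M : manifold V) (E : vbundle M).

Definition pullback_dom (i : frame_idx E) : set (line_prod M) :=
  [set p | frame_dom i p.2].

Lemma pullback_dom_open i : open (pullback_dom i).
Proof.
have -> : pullback_dom i = setT `*` frame_dom i.
  by apply/seteqP; split=> p //= [].
by apply: open_prod; [exact: openT|exact: frame_dom_open].
Qed.

Lemma pullback_dom_cover (p : line_prod M) : exists i, pullback_dom i p.
Proof. by have [i ip] := frame_cover E p.2; exists i. Qed.

Lemma smooth_pullback (U : set M) (f : M -> R) :
  smooth_fun_on U f ->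
  @smooth_fun_on _ _ (line_prod M) [set p | U p.2] (fun p => f p.2).
Proof.
move=> sf i; have [g sg gE] := sf i.
exists (fun q => g q.2); last by move=> p Up ip; rewrite gE.
rewrite (_ : _ @` _ =
    [set q | (@chart _ _ M i @` (U `&` @chart_dom _ _ M i)) q.2]).
  exact: smooth_on_snd.
apply/seteqP; split=> [_ [p [Up ip] <-]|[t _] /= [x [Ux ix] <-]].
  by exists p.2.
by exists (t, x).
Qed.

(* The pullback of E along the projection R * M -> M. *)
Definition pullback_line : vbundle (line_prod M) :=
  @Vbundle R _ (line_prod M) (fun p => E p.2) (frame_idx E)
    (@frame_rank _ _ _ E) pullback_dom (fun i p => frame i p.2)
    pullback_dom_open pullback_dom_cover
    (fun i p => @frame_basis _ _ _ E i p.2)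
    (fun i j k l => smooth_pullback (@frame_smooth _ _ _ E i j k l)).

End pullback.

(* All sections, smooth or not; Gamma E is the set of the smooth ones. The
   operators below are defined on all sections, but their hypotheses and
   conclusions only involve their values on smooth ones. *)
Definition section (R : realType) (V : normedModType R) (M : manifold V)
    (E : vbundle M) : Type := forall x : M, E x.

Definition Gamma (R : realType) (V : normedModType R) (M : manifold V)
    (E : vbundle M) : set (section E) :=
  [set s | forall i k, smooth_fun_on (@frame_dom _ _ _ E i)
                         (fun x => coord (frame i x) k (s x))].

Definition endo (R : realType) (V : normedModType R) (M : manifold V)
    (E : vbundle M) : Type := forall x : M, 'End(E x).

Definition GammaEnd (R : realType) (V : normedModType R) (M : manifold V)
    (E : vbundle M) : set (endo E) :=
  [set T | forall i k l, smooth_fun_on (@frame_dom _ _ _ E i)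
             (fun x => coord (frame i x) k (T x (tnth (frame i x) l)))].

Definition fibre_trace (R : realType) (F : vectType R) (f : 'End(F)) : R :=
  \sum_i coord (vbasis {:F}) i (f (tnth (vbasis {:F}) i)).

(* The element of Gamma(End E) by which a C^oo(M)-linear operator P on Gamma E
   acts: at x, the endomorphism T of the fibre with (P s)(x) = T (s x) for all
   smooth s (0 if there is none; it is unique, since every vector extends to a
   smooth section). *)
Definition endo_of (R : realType) (V : normedModType R) (M : manifold V)
    (E : vbundle M) (P : section E -> section E) : endo E :=
  fun x => xget 0 [set T : 'End(E x) |
                    forall s : section E, Gamma s -> P s x = T (s x)].

Record lie_algebroid (R : realType) (V : normedModType R) (M : manifold V) :=
  LieAlgebroid {
  lie_bundle :> vbundle M;
  anchor : forall x : M, lie_bundle x -> (M -> R) -> R;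
  bracket : section lie_bundle -> section lie_bundle -> section lie_bundle;
  anchor_tangent : forall x u, tangent x (@anchor x u);
  anchor_linear : forall x c (u v : lie_bundle x) f, Cinf f ->
    anchor (c *: u + v) f = c * anchor u f + anchor v f;
  anchor_smooth : forall (a : section lie_bundle) f, Gamma a -> Cinf f ->
    Cinf (fun x => anchor (a x) f);
  bracket_smooth : forall a b, Gamma a -> Gamma b -> Gamma (bracket a b);
  bracket_linear : forall c a b d, Gamma a -> Gamma b -> Gamma d -> forall x,
    bracket (fun y => c *: a y + b y) d x = c *: bracket a d x + bracket b d x;
  bracket_antisym : forall a b, Gamma a -> Gamma b -> forall x,
    bracket a b x = - bracket b a x;
  bracket_jacobi : forall a b c, Gamma a -> Gamma b -> Gamma c -> forall x,
    bracket a (bracket b c) x + bracket b (bracket c a) x +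
    bracket c (bracket a b) x = 0;
  bracket_leibniz : forall a b f, Gamma a -> Gamma b -> Cinf f -> forall x,
    bracket a (fun y => f y *: b y) x =
    f x *: bracket a b x + anchor (a x) f *: b x }.

Definition has_symbol (R : realType) (V : normedModType R) (M : manifold V)
    (E : vbundle M) (l : section E -> section E) (X : M -> (M -> R) -> R) :
    Prop :=
  forall f (s : section E), Cinf f -> Gamma s -> forall x,
    l (fun y => f y *: s y) x = f x *: l s x + X x f *: s x.

Definition CDO (R : realType) (V : normedModType R) (M : manifold V)
    (E : vbundle M) : set (section E -> section E) :=
  [set l |
    [/\ forall s : section E, Gamma s -> Gamma (l s),
        forall c (s t : section E), Gamma s -> Gamma t -> forall x,
          l (fun y => c *: s y + t y) x = c *: l s x + l t x &
        exists X, [/\ vector_field X, has_symbol l X &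
          forall Y, vector_field Y -> has_symbol l Y ->
            forall x f, Cinf f -> Y x f = X x f]]].

Definition connection (R : realType) (V : normedModType R) (M : manifold V)
    (A : lie_algebroid M) (E : vbundle M)
    (D : section A -> section E -> section E) : Prop :=
  [/\ forall a, Gamma a -> CDO (D a),
      forall a, Gamma a -> has_symbol (D a) (fun x => anchor (a x)) &
      forall c (a b : section A) (s : section E),
        Gamma a -> Gamma b -> Gamma s -> forall x,
        D (fun y => c *: a y + b y) s x = c *: D a s x + D b s x].

(* Curvature and Chern character of operators D_a on Gamma F indexed by a in a
   real Lie algebra L with bracket br: L is Gamma(A), or the Lie subalgebra of
   Gamma(T R x A) on which nabla^aff is needed. *)
Definition curvature (R : realType) (V : normedModType R) (N : manifold V)
    (F : vbundle N) (L : Type) (br : L -> L -> L)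
    (D : L -> section F -> section F) (a b : L) (s : section F) : section F :=
  fun y => D a (D b s) y - D b (D a s) y - D (br a b) s y.

Definition curvature_form (R : realType) (V : normedModType R) (N : manifold V)
    (F : vbundle N) (L : Type) (br : L -> L -> L)
    (D : L -> section F -> section F) (b : 'I_2 -> L) : endo F :=
  endo_of (curvature br D (b ord0) (b ord_max)).

Fact pair_idx_subproof p (i : 'I_p) (e : bool) : (i.*2 + e < p.*2)%N.
Proof.
have /leq_trans-> // : (i.*2 + e < i.+1.*2)%N.
  by rewrite doubleS -addn2 ltn_add2l; case: e.
by rewrite leq_double.
Qed.

Definition pair_idx p (i : 'I_p) (e : bool) : 'I_p.*2 :=
  Ordinal (pair_idx_subproof i e).

Definition chern (R : realType) (V : normedModType R) (N : manifold V)
    (F : vbundle N) (L : Type) (br : L -> L -> L)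
    (D : L -> section F -> section F) (p : nat) (b : 'I_p.*2 -> L) (y : N) : R :=
  let curv (u v : L) : 'End(F y) := endo_of (curvature br D u v) y in
  fibre_trace ((2 ^+ p)^-1 *: \sum_(tau : 'S_p.*2) (-1) ^+ tau *:
    \big[@comp_lfun _ _ _ _ / \1%VF]_(i < p)
      curv (b (tau (pair_idx i false))) (b (tau (pair_idx i true)))).

Definition End_form (R : realType) (V : normedModType R) (M : manifold V)
    (A : lie_algebroid M) (E : vbundle M) (n : nat) : Type :=
  ('I_n -> section A) -> endo E.

Definition alt_form (R : realType) (V : normedModType R) (M : manifold V)
    (A : lie_algebroid M) (E : vbundle M) (n : nat) (w : End_form A E n) :
    Prop :=
  let set_arg a i u : 'I_n -> section A := fun j => if j == i then u else a j in
  [/\ forall a, (forall i, Gamma (a i)) -> GammaEnd (w a),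
      forall a (i : 'I_n) c (u v : section A),
        (forall j, Gamma (a j)) -> Gamma u -> Gamma v -> forall x,
        w (set_arg a i (fun y => c *: u y + v y)) x =
        c *: w (set_arg a i u) x + w (set_arg a i v) x &
      forall a (tau : 'S_n), (forall j, Gamma (a j)) -> forall x,
        w (fun j => a (tau j)) x = (-1) ^+ tau *: w a x].

Definition End_wedge (R : realType) (V : normedModType R) (M : manifold V)
    (A : lie_algebroid M) (E : vbundle M) (m n : nat)
    (w : End_form A E m) (h : End_form A E n) : End_form A E (m + n) :=
  fun a x => (m`!%:R * n`!%:R)^-1 *: \sum_(tau : 'S_(m + n)) (-1) ^+ tau *:
    (w (fun i => a (tau (lshift n i))) x \o
     h (fun j => a (tau (rshift m j))) x)%VF.

Definition conn_End (R : realType) (V : normedModType R) (M : manifold V)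
    (A : lie_algebroid M) (E : vbundle M)
    (D : section A -> section E -> section E) (a : section A) (T : endo E) :
    endo E :=
  endo_of (fun s x => D a (fun y => T y (s y)) x - T x (D a s x)).

Definition d_End (R : realType) (V : normedModType R) (M : manifold V)
    (A : lie_algebroid M) (E : vbundle M)
    (D : section A -> section E -> section E) (w : End_form A E 1) :
    End_form A E 2 :=
  fun a x =>
    let a1 := a ord0 in let a2 := a ord_max in
    conn_End D a1 (w (fun=> a2)) x - conn_End D a2 (w (fun=> a1)) x
    - w (fun=> bracket a1 a2) x.

Definition conn_add (R : realType) (V : normedModType R) (M : manifold V)
    (A : lie_algebroid M) (E : vbundle M)
    (D : section A -> section E -> section E) (w : End_form A E 1) :
    section A -> section E -> section E :=
  fun a s x => D a s x + w (fun=> a) x (s x).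

Definition flat (R : realType) (V : normedModType R) (M : manifold V)
    (A : lie_algebroid M) (E : vbundle M)
    (D : section A -> section E -> section E) : Prop :=
  forall (a b : section A) (s : section E),
    Gamma a -> Gamma b -> Gamma s -> forall x,
    curvature (@bracket _ _ _ A) D a b s x = 0.

(* The derivative of a curve in a finite-dimensional vector space. *)
Definition fibre_derive (R : realType) (F : vectType R) (u : R -> F) (t : R) :
    F :=
  \sum_k (fun s => coord (vbasis {:F}) k (u s))^`()%classic t *:
    tnth (vbasis {:F}) k.

(* The sections of T R x A on which nabla^aff is needed: (c, a) stands for
   c d/dt x a, with c a real constant and a in Gamma(A) independent of t. They
   form a Lie subalgebra, with [d/dt, a] = 0. *)
Definition aff_section (R : realType) (V : normedModType R) (M : manifold V)
    (A : lie_algebroid M) : Type := (R * section A)%type.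

Definition aff_bracket (R : realType) (V : normedModType R) (M : manifold V)
    (A : lie_algebroid M) (u v : aff_section A) : aff_section A :=
  (0, bracket u.2 v.2).

(* A section mu of pr_2^* E is a family mu_t of sections of E, and the
   extension by the Leibniz rule of the operators given on sections nu o pr_2
   is nabla_{d/dt} mu = d mu_t / dt and
   nabla_a mu = (1 - t) nabla^0_a mu_t + t nabla^1_a mu_t. *)
Definition aff_conn (R : realType) (V : normedModType R) (M : manifold V)
    (A : lie_algebroid M) (E : vbundle M)
    (D0 D1 : section A -> section E -> section E)
    (u : aff_section A) (mu : section (pullback_line E)) :
    section (pullback_line E) :=
  fun p =>
    let slice t : section E := fun x => mu (t, x) in
    u.1 *: fibre_derive (fun t => slice t p.2) p.1
    + ((1 - p.1) *: D0 u.2 (slice p.1) p.2 + p.1 *: D1 u.2 (slice p.1) p.2).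

Definition cons_args (L : Type) (n : nat) (c : L) :
    ('I_n.-1 -> L) -> 'I_n -> L :=
  if n is m.+1 then fun a j => oapp a c (unlift ord0 j) else fun _ _ => c.

(* Meaningful for p >= 1; (t, x) is a point of R * M. *)
Definition chern_simons (R : realType) (V : normedModType R) (M : manifold V)
    (A : lie_algebroid M) (E : vbundle M) (p : nat)
    (D0 D1 : section A -> section E -> section E)
    (a : 'I_p.*2.-1 -> section A) (x : M) : R :=
  \int[lebesgue_measure]_(t in `[0, 1]%classic)
    chern (@aff_bracket _ _ _ A) (aff_conn D0 D1) (p := p)
      (cons_args (1, fun=> 0) (fun i => (0, a i))) (t, x).

(* Main.v *)
(** Put nabla^t = nabla + t theta. The curvature of the affine combination is
    theta(a) on (d/dt, a), and on (a, b) it is the curvature of nabla^t, which is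
    R + t d theta + t^2 [theta, theta]. So ch_p (p = 1, 2) is a polynomial in t,
    and the antisymmetry of the curvature and the cyclicity of the trace reduce
    its coefficients to those of the stated wedge products; flatness at t = 0
    and t = 1 gives R = 0 and d theta = - [theta, theta].

    The curvature on (d/dt, a) needs [d/dt, nabla_a] = 0, and the curvature on
    (a, b) has to be a section of End E. No locality of the operators is used:
    for a cutoff function chi with chi x = 1, supported in the domain of a frame
    e, the global identity chi^2 s = sum_k (chi s^k) (chi e_k) turns every claim
    at x into one on coefficients, namely the symmetry of mixed partial
    derivatives and the Leibniz rule. *)

From HB Require Import structures.
Require Import Defs.
From mathcomp Require Import all_boot all_order all_algebra all_fingroup.
From mathcomp Require Import all_classical all_reals all_analysis.
From mathcomp Require Import ring lra.
Import Order.TTheory GRing.Theory Num.Theory.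
Import numFieldNormedType.Exports.
Local Open Scope classical_set_scope.
Local Open Scope ring_scope.
Set Implicit Arguments.
Unset Strict Implicit.
Unset Printing Implicit Defensive.

(** * Calculus on normed spaces *)

(** The operators [D a] carry no continuity hypothesis, so d/dt cannot simply be passed through
    them. After expansion in a cutoff frame, [D a] meets only the fixed sections chi e_k, and t
    occurs only in scalar coefficients, on which the anchor acts as a directional derivative. The
    two factors chi have different tasks: one turns a frame vector into a global smooth section, the
    other turns a coefficient into a global smooth function, and the Leibniz rule is available for
    global objects only. Tensoriality of the curvature rests on the anchor preserving brackets,
    which is derived from the Jacobi and Leibniz identities. Origin of the constants: in each
    product of two curvatures in ch_2, exactly one factor contains d/dt, and it equals plus or minus
    theta of an argument, free of t. The integrand is therefore quadratic in t, with a common factor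
    2, and integrating 1, t, t^2 gives 2, 1, 2/3. In the flat case -1 + 2/3 = -1/3. *)

Section Ck_calculus.
Context (R : realType).
Implicit Types (V W : normedModType R).

Lemma Ck_onS V W k (U : set V) (f : V -> W) : Ck_on k.+1 U f -> Ck_on k U f.
Proof.
elim: k f => [|k IH] f; first by move=> [df _] x /df /differentiable_continuous.
by move=> [df Df]; split => // v; apply: IH; exact: Df.
Qed.

Lemma Ck_on_subset V W k (U U' : set V) (f : V -> W) :
  U' `<=` U -> Ck_on k U f -> Ck_on k U' f.
Proof.
move=> sU; elim: k f => [|k IH] f /=; first by move=> cf x /sU; exact: cf.
by move=> [df Df]; split=> [x /sU|v]; [exact: df|exact: IH].
Qed.

(** Differentiability at a point already concerns a neighbourhood, and ['D_v f] is a total function,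
    so singletons suffice. This makes smoothness a local property. *)
Lemma Ck_on_pointwise V W k (U : set V) (f : V -> W) :
  (forall x, U x -> Ck_on k [set x] f) -> Ck_on k U f.
Proof.
elim: k f => [|k IH] f /= H; first by move=> x Ux; exact: (H x Ux).
split=> [x Ux|v]; first by have [df _] := H x Ux; exact: df.
by apply: IH => x /H [_]; apply.
Qed.

Lemma Ck_on_local V W k (U : set V) (f : V -> W) :
  (forall x, U x -> exists2 U', open_nbhs x U' &
     exists2 g, {in U', g =1 f} & Ck_on k U' g) -> Ck_on k U f.
Proof.
move=> H; apply: Ck_on_pointwise => x /H[U' [oU' U'x] [g gf cg]].
by apply: (@Ck_on_subset _ _ _ U') (Ck_on_ext oU' gf cg) => _ ->.
Qed.

Lemma Ck_onD V W k (U : set V) (f g : V -> W) : open U ->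
  Ck_on k U f -> Ck_on k U g -> Ck_on k U (fun x => f x + g x).
Proof.
move=> oU; elim: k f g => [|k IH] f g /=.
  by move=> cf cg x Ux; apply: cvgD; [exact: cf|exact: cg].
move=> [df Df] [dg Dg]; split=> [x Ux|v].
  by apply: differentiableD; [exact: df|exact: dg].
apply: Ck_on_ext (IH _ _ (Df v) (Dg v)) => // x /set_mem Ux.
by rewrite -deriveD //; apply: diff_derivable; [exact: df|exact: dg].
Qed.

Lemma Ck_onM V k (U : set V) (f g : V -> R) : open U ->
  Ck_on k U f -> Ck_on k U g -> Ck_on k U (fun x => f x * g x).
Proof.
move=> oU; elim: k f g => [|k IH] f g /=.
  by move=> cf cg x Ux; apply: cvgM; [exact: cf|exact: cg].
move=> [df Df] [dg Dg]; split=> [x Ux|v].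
  by apply: differentiableM; [exact: df|exact: dg].
have cf : Ck_on k U f by apply: Ck_onS; split.
have cg : Ck_on k U g by apply: Ck_onS; split.
apply: Ck_on_ext (Ck_onD oU (IH _ _ cf (Dg v)) (IH _ _ cg (Df v))) => //.
move=> x /set_mem Ux.
by rewrite -deriveM //; apply: diff_derivable; [exact: df|exact: dg].
Qed.

Lemma smooth_onD V W (U : set V) (f g : V -> W) : open U ->
  smooth_on U f -> smooth_on U g -> smooth_on U (fun x => f x + g x).
Proof. by move=> oU sf sg k; exact: Ck_onD. Qed.

Lemma smooth_onM V (U : set V) (f g : V -> R) : open U ->
  smooth_on U f -> smooth_on U g -> smooth_on U (fun x => f x * g x).
Proof. by move=> oU sf sg k; exact: Ck_onM. Qed.

Lemma smooth_on_subset V W (U U' : set V) (f : V -> W) :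
  U' `<=` U -> smooth_on U f -> smooth_on U' f.
Proof. by move=> sU sf k; exact: Ck_on_subset sU (sf k). Qed.

Lemma smooth_on_ext V W (U : set V) (f g : V -> W) :
  open U -> {in U, f =1 g} -> smooth_on U f -> smooth_on U g.
Proof. by move=> oU fg sf k; exact: Ck_on_ext oU fg (sf k). Qed.

Lemma smooth_on_derive V W (U : set V) (f : V -> W) v :
  smooth_on U f -> smooth_on U (fun x => 'D_v f x).
Proof. by move=> sf k; have [_] := sf k.+1; apply. Qed.

Lemma smooth_on_differentiable V W (U : set V) (f : V -> W) x :
  smooth_on U f -> U x -> differentiable f x.
Proof. by move=> sf Ux; have [+ _] := sf 1%N; apply. Qed.

Lemma smooth_on_derivable V W (U : set V) (f : V -> W) x v :
  smooth_on U f -> U x -> derivable f x v.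
Proof. by move=> sf Ux; exact/diff_derivable/(smooth_on_differentiable sf Ux). Qed.

Lemma smooth_on_linear_comp V W W' (U : set V) (f : V -> W)
    (l : {linear W -> W'}) : open U -> continuous l ->
  smooth_on U f -> smooth_on U (fun x => l (f x)).
Proof.
move=> oU cl sf k; have := sf k; clear sf; elim: k f => [|k IH] f /=.
  move=> cf x Ux; apply: (@cvg_comp _ _ _ f l); [exact: cf|exact: cl].
move=> [df Df]; split=> [x Ux|v].
  apply: (@differentiable_comp _ _ _ _ f l); first exact: df.
  exact: linear_differentiable.
apply: Ck_on_ext (IH _ (Df v)) => // x /set_mem Ux.
rewrite !deriveE ?(@diff_comp _ _ _ _ f l) ?diff_lin//=; try exact: df.
- exact: linear_differentiable.
- apply: (@differentiable_comp _ _ _ _ f l); first exact: df.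
  exact: linear_differentiable.
Qed.

(** The chain rule replaces phi_j by phi_(j+1), so the whole sequence of successive derivatives is
    carried through the induction on the order k. *)
Lemma smooth_on_comp_real V (U : set V) (u : V -> R) (phi : nat -> R -> R)
    (j : nat) :
  open U -> (forall i (x : R), is_derive x 1 (phi i) (phi i.+1 x)) ->
  smooth_on U u -> smooth_on U (fun x => phi j (u x)).
Proof.
move=> oU dphi su k; have cu := su k; clear su.
have diffphi i x : differentiable (phi i) x.
  by apply/derivable1_diffP; have [] := dphi i x.
elim: k j u cu => [|k IH] j u /=.
  move=> cu x Ux; apply: (@cvg_comp _ _ _ u (phi j)); first exact: cu.
  exact: (differentiable_continuous (diffphi j (u x))).
move=> [du Du]; split=> [x Ux|v].
  by apply: (@differentiable_comp _ _ _ _ u (phi j)); [exact: du|].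
have cu : Ck_on k U u by apply: Ck_onS; split.
apply: Ck_on_ext (Ck_onM oU (IH j.+1 _ cu) (Du v)) => // x /set_mem Ux.
rewrite [RHS]deriveE; last first.
  by apply: (@differentiable_comp _ _ _ _ u (phi j)); [exact: du|].
rewrite (@diff_comp _ _ _ _ u (phi j)) /=; [|exact: du|exact: diffphi].
rewrite -(deriveE v (du x Ux)) diff1E // derive1E; have [_ ->] := dphi j (u x).
by rewrite mulrC.
Qed.

(** The two difference quotients are the same function of h, so no differentiability is involved. *)
Lemma derive_slice V1 V2 W (f : V1 * V2 -> W) (s : V1) x w :
  'D_w (fun y => f (s, y)) x = 'D_(0, w) f (s, x).
Proof.
rewrite /derive; apply: (congr1 (fun F : R -> W => lim (F @ 0^'))).
apply/funext => h /=.
suff <- : h *: (0, w) + (s, x) = (s, h *: w + x) by [].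
by apply: injective_projections; rewrite /= ?scaler0 ?add0r.
Qed.

Lemma derive_slicel V1 V2 W (f : V1 * V2 -> W) (s : V1) x w :
  'D_w (fun y => f (y, x)) s = 'D_(w, 0) f (s, x).
Proof.
rewrite /derive; apply: (congr1 (fun F : R -> W => lim (F @ 0^'))).
apply/funext => h /=.
suff <- : h *: (w, 0) + (s, x) = (h *: w + s, x) by [].
by apply: injective_projections; rewrite /= ?scaler0 ?add0r.
Qed.

Lemma smooth_on_slice V1 V2 W (U : set (V1 * V2)) (f : V1 * V2 -> W) (s : V1) :
  smooth_on U f -> smooth_on [set y | U (s, y)] (fun y => f (s, y)).
Proof.
move=> sf k; have := sf k; clear sf; elim: k f => [|k IH] f /=.
  move=> cf y Uy; apply: (@cvg_comp _ _ _ (pair s) f); last exact: cf.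
  by apply: cvg_pair; [exact: cvg_cst|exact: cvg_id].
move=> [df Df]; split=> [y Uy|v].
  apply: (@differentiable_comp _ _ _ _ (pair s) f); last exact: df.
  exact: differentiable_pair.
have E : (fun y => 'D_v (fun y => f (s, y)) y) = (fun y => 'D_(0, v) f (s, y)).
  by apply/funext => y; rewrite derive_slice.
by rewrite E; apply: IH (Df (0, v)).
Qed.

End Ck_calculus.

(** * Symmetry of mixed directional derivatives *)

Section mixed_derivatives.
Context (R : realType) (V : normedModType R).
Implicit Types (U : set V) (f : V -> R).

Lemma is_derive_line f (p v : V) (s : R) :
  derivable f (p + s *: v) v ->
  is_derive s 1 (fun s => f (p + s *: v)) ('D_v f (p + s *: v)).
Proof.
move=> df.
have E : (fun h : R => h^-1 *: (((fun s => f (p + s *: v)) \o shift s) (h *: 1) -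
            f (p + s *: v))) =
         (fun h => h^-1 *: ((f \o shift (p + s *: v)) (h *: v) -
            f (p + s *: v))).
  apply/funext => h /=; congr (_ *: (f _ - _)).
  by rewrite scalerDl addrCA; congr (_ + _); rewrite /GRing.scale/= mulr1.
by apply: DeriveDef; rewrite /derivable /derive E.
Qed.

(** The mean value theorem is used twice: along v for the increment of f by d w, then along w for
    ['D_v f]. The left-hand side is symmetric in v and w, which is what [derive_mixed] exploits. *)
Lemma second_difference U f (p v w : V) (d : R) : 0 < d ->
  smooth_on U f ->
  (forall s t, 0 <= s <= d -> 0 <= t <= d -> U (p + s *: v + t *: w)) ->
  exists c e, [/\ 0 <= c <= d, 0 <= e <= d &
    f (p + d *: v + d *: w) - f (p + d *: v) - f (p + d *: w) + f p =
    d * d * 'D_w (fun x => 'D_v f x) (p + c *: v + e *: w)].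
Proof.
move=> d0 sf HU; have d00 : 0 <= d by exact: ltW.
have dd : 0 <= d <= d by rewrite d00 lexx.
have z0 : 0 <= (0 : R) <= d by rewrite lexx d00.
pose g (s : R) := f (p + d *: w + s *: v) - f (p + s *: v).
pose g' (s : R) := 'D_v f (p + d *: w + s *: v) - 'D_v f (p + s *: v).
have dg (s : R) : 0 <= s <= d -> is_derive s 1 g (g' s).
  move=> s0d; apply: is_deriveB; apply: is_derive_line.
    by apply: smooth_on_derivable sf _; rewrite addrAC; exact: HU.
  apply: smooth_on_derivable sf _.
  by have := HU s 0 s0d z0; rewrite scale0r addr0.
have [||c] := @MVT_segment R g g' 0 d d00.
- by move=> x; rewrite in_itv => /andP[x0 xd]; apply: dg; rewrite !ltW.
- by apply: derivable_within_continuous => y; rewrite in_itv => /dg[].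
rewrite in_itv => /= c0d; rewrite subr0 => gE.
have sDf := smooth_on_derive v sf.
pose h (t : R) := 'D_v f (p + c *: v + t *: w).
pose h' (t : R) := 'D_w (fun x => 'D_v f x) (p + c *: v + t *: w).
have dh (t : R) : 0 <= t <= d -> is_derive t 1 h (h' t).
  by move=> t0d; apply: is_derive_line; apply: smooth_on_derivable sDf _; exact: HU.
have [||e] := @MVT_segment R h h' 0 d d00.
- by move=> x; rewrite in_itv => /andP[x0 xd]; apply: dh; rewrite !ltW.
- by apply: derivable_within_continuous => y; rewrite in_itv => /dh[].
rewrite in_itv => /= e0d; rewrite subr0 => hE.
exists c, e; split => //.
transitivity (g d - g 0).
  rewrite /g !scale0r !addr0 [p + d *: w + _]addrAC opprB -!addrA.
  by do 2 congr (_ + _); rewrite addrC.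
rewrite gE (_ : g' c = h d - h 0).
  by rewrite hE -/(h' e) mulrC mulrA mulrAC.
by rewrite /g' /h scale0r addr0 addrAC.
Qed.

Let ltr_dist_split (a b c e : R) :
  `|a - c| < e / 2 -> `|b - c| < e / 2 -> `|a - b| < e.
Proof.
move=> ac bc; have -> : a - b = (a - c) - (b - c) by rewrite opprB addrA subrK.
by rewrite (le_lt_trans (ler_normB _ _))// (splitr e) ltrD.
Qed.

(** The second difference, read in both orders, shows that the two mixed derivatives agree at some
    pair of points of a small parallelogram at p; both are continuous at p, so their values there
    differ by less than any e. *)
Lemma derive_mixed U f (p v w : V) : open U -> U p -> smooth_on U f ->
  'D_v (fun x => 'D_w f x) p = 'D_w (fun x => 'D_v f x) p.
Proof.
move=> oU Up sf.
pose A x := 'D_v (fun x => 'D_w f x) x.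
pose B x := 'D_w (fun x => 'D_v f x) x.
have cA : {for p, continuous A}.
  exact (smooth_on_derive v (smooth_on_derive w sf) 0%N p Up).
have cB : {for p, continuous B}.
  exact (smooth_on_derive w (smooth_on_derive v sf) 0%N p Up).
change (A p = B p); apply/eqP; rewrite -subr_eq0 -normr_le0.
apply/ler_addgt0Pl => e e0; rewrite addr0.
have e2 : 0 < e / 2 by rewrite divr_gt0.
have nU : nbhs p U by exact: open_nbhs_nbhs.
have nA : \forall x \near p, `|A p - A x| < e / 2.
  by move/cvgrPdist_lt : cA; apply.
have nB : \forall x \near p, `|B p - B x| < e / 2.
  by move/cvgrPdist_lt : cB; apply.
have c1 : (fun st : R * R => st.1 *: v) @ (0, 0) --> (0 : R) *: v.
  by apply: cvgZr_tmp; exact: cvg_fst.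
have c2 : (fun st : R * R => st.2 *: w) @ (0, 0) --> (0 : R) *: w.
  by apply: cvgZr_tmp; exact: cvg_snd.
have cl : (fun st : R * R => p + st.1 *: v + st.2 *: w) @ (0, 0) -->
    p + (0 : R) *: v + (0 : R) *: w.
  by apply: cvgD; [apply: cvgD; [exact: cvg_cst|exact: c1]|exact: c2].
rewrite !scale0r !addr0 in cl.
have [Q nQ HQ] : exists2 Q, nbhs p Q & forall x, Q x ->
    [/\ U x, `|A p - A x| < e / 2 & `|B p - B x| < e / 2].
  by eexists; [exact (filterI nU (filterI nA nB))|move=> x [? []]].
have {cl nQ}/nbhs_ballP [d /= d0 Hd] := cl Q nQ.
have d2 : 0 < d / 2 by rewrite divr_gt0.
have dd : 0 <= d / 2 <= d / 2 by rewrite lexx ltW.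
have H s t : 0 <= s <= d / 2 -> 0 <= t <= d / 2 ->
    [/\ U (p + s *: v + t *: w), `|A p - A (p + s *: v + t *: w)| < e / 2 &
        `|B p - B (p + s *: v + t *: w)| < e / 2].
  move=> /andP[s0 sd] /andP[t0 td]; apply: HQ; apply: (Hd (s, t)); split;
    rewrite /ball /= sub0r normrN ger0_norm//;
    [move: sd|move: td] => /le_lt_trans; apply; lra.
have HU s t (s0 : 0 <= s <= d / 2) (t0 : 0 <= t <= d / 2) :
  U (p + s *: v + t *: w) by have [] := H s t s0 t0.
have HU' s t (s0 : 0 <= s <= d / 2) (t0 : 0 <= t <= d / 2) :
  U (p + s *: w + t *: v) by rewrite addrAC; exact: HU.
have [c [c' [c0 c0' E1]]] := second_difference d2 sf HU.
have [b [b' [b0 b0' E2]]] := second_difference d2 sf HU'.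
have EAB : A (p + b *: w + b' *: v) = B (p + c *: v + c' *: w).
  have dn0 : d / 2 * (d / 2) != 0 by rewrite mulf_neq0// gt_eqF.
  apply: (mulfI dn0); apply: etrans (esym E2) (etrans _ E1).
  by rewrite [p + d / 2 *: w + _]addrAC; congr (_ + _); rewrite [LHS]addrAC.
have [_ HA _] := H b' b b0' b0; rewrite addrAC EAB in HA.
have [_ _ HB] := H c c' c0 c0'.
exact (ltW (ltr_dist_split HA HB)).
Qed.

End mixed_derivatives.

(** * The functions P(1/x) exp(-1/x) *)

Section flat.
Context (R : realType).
Implicit Types (P : {poly R}) (x : R).

(** The polynomial makes the family closed under differentiation: P is replaced by X^2 (P - P'). All
    derivatives of exp(-1/x) are thus treated at once. *)
Definition flat_fun P x : R := if 0 < x then P.[x^-1] * expR (- x^-1) else 0.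

(** For k > 0, exp(x) = exp(x/k)^k >= (1 + x/k)^k >= (x/k)^k. *)
Lemma expr_expRN_bound k x : 0 <= x -> x ^+ k * expR (- x) <= k%:R ^+ k.
Proof.
move=> x0; rewrite expRN ler_pdivrMr ?expR_gt0//.
case: k => [|k]; first by rewrite !expr0 mul1r -expR0 ler_expR.
rewrite [in expR x](_ : x = k.+1%:R * (x / k.+1%:R)); last first.
  by rewrite mulrC divfK.
rewrite expRM_natl -exprMn ler_pXn2r ?nnegrE//.
  rewrite -ler_pdivrMl// mulrC.
  by apply: le_trans (expR_ge1Dx _); rewrite lerDr.
Qed.

Lemma horner_expRN_bound P :
  exists C, forall x, 0 <= x -> `|P.[x] * expR (- x)| <= C.
Proof.
exists (\sum_(i < size P) `|P`_i| * i%:R ^+ i) => x x0.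
rewrite horner_coef mulr_suml; apply: le_trans (ler_norm_sum _ _ _) _.
apply: ler_sum => i _; rewrite -mulrA normrM ler_wpM2l//.
rewrite ger0_norm; first exact: expr_expRN_bound.
by rewrite mulr_ge0 ?expR_ge0 ?exprn_ge0.
Qed.

Lemma is_derive_flat_fun P x :
  is_derive x 1 (flat_fun P) (flat_fun ('X^2 * (P - P^`())) x).
Proof.
have [x0|x0|->] := ltrgtP x 0.
- have E : \forall y \near x, cst 0 y = flat_fun P y.
    near=> y; rewrite /flat_fun; case: ifPn => // y0.
    have : y < 0 by near: y; exact: lt_nbhsl.
    by move=> /(lt_trans y0); rewrite ltxx.
  apply: near_eq_is_derive E _ => //.
  by rewrite /flat_fun ltNge (ltW x0); exact: is_derive_cst.
- have E : \forall y \near x, P.[y^-1] * expR (- y^-1) = flat_fun P y.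
    near=> y; rewrite /flat_fun; case: ifPn => // /negP[].
    by near: y; exact: lt_nbhsr.
  apply: near_eq_is_derive E _ => //.
  rewrite /flat_fun x0; set d := (X in is_derive _ _ _ X).
  have xn0 : x != 0 by rewrite gt_eqF.
  have dV : is_derive x 1 (fun y : R => y^-1) (- x ^- 2).
    apply: is_derive_eq; first exact: is_deriveV.
    by rewrite /GRing.scale /= mulr1.
  have dP : is_derive (x^-1) 1 (horner P) (P^`().[x^-1]).
    apply: DeriveDef; first exact: derivable_horner.
    by rewrite -derive1E -derivE.
  have dPV := is_derive1_comp dP dV.
  have dNV : is_derive x 1 (fun y : R => - y^-1) (x ^- 2).
    by rewrite -[x ^- 2]opprK; exact: (is_deriveN dV).
  have dE : is_derive x 1 (fun y : R => expR (- y^-1)) (expR (- x^-1) * x ^- 2).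
    exact: (@is_derive1_comp _ expR (fun y : R => - y^-1) _ _ _
      (is_derive_expR (- x^-1)) dNV).
  have H : is_derive x 1 (fun y : R => P.[y^-1] * expR (- y^-1))
      (P.[x^-1] *: (expR (- x^-1) * x ^- 2) +
       expR (- x^-1) *: (P^`().[x^-1] * - x ^- 2)).
    exact: (is_deriveM dPV dE).
  apply: is_derive_eq H _.
  rewrite /d /GRing.scale /= !hornerE /=.
  rewrite -exprVn; set y := x^-1; ring.
- rewrite {2}/flat_fun ltxx.
  suff H : (fun h : R => h^-1 *: ((flat_fun P \o shift 0) (h *: 1) -
      flat_fun P 0)) @ 0^' --> (0 : R).
    by apply: DeriveDef; [apply/cvg_ex; exists 0|exact: cvg_lim].
  have [C HC] := horner_expRN_bound ('X^2 * P).
  apply/cvgrPdist_le => e e0.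
  have C1 : 0 < `|C| + 1 by rewrite ltr_wpDl.
  near=> h; rewrite sub0r normrN /= (_ : h *: 1 = h) ?addr0; last exact: mulr1.
  rewrite /flat_fun ltxx subr0; case: ifPn => h0; last by rewrite scaler0 normr0 ltW.
  (* Two powers of 1/h are moved into the polynomial: the quotient becomes h times a bounded
     quantity. *)
  rewrite (_ : h^-1 *: _ = h * (('X^2 * P).[h^-1] * expR (- h^-1))); last first.
    change (h^-1 * (P.[h^-1] * expR (- h^-1)) = h * (('X^2 * P).[h^-1] * expR (- h^-1))).
    by rewrite hornerM hornerXn expr2 -!mulrA [RHS]mulVKf ?gt_eqF.
  rewrite normrM gtr0_norm//.
  have hV : 0 <= h^-1 by rewrite invr_ge0 ltW.
  apply: (@le_trans _ _ (h * (`|C| + 1))).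
    apply: (ler_wpM2l (ltW h0)); apply: le_trans (HC _ hV) _.
    by rewrite ler_wpDr// ler_norm.
  rewrite -ler_pdivlMr// ltW//.
  rewrite -[ltLHS](gtr0_norm h0); near: h.
  by apply: dnbhs0_lt; exact: divr_gt0.
Unshelve. all: by end_near. Qed.

Definition flat_exp (x : R) : R := flat_fun 1 x.

Lemma flat_exp_gt0 x : 0 < x -> 0 < flat_exp x.
Proof. by move=> x0; rewrite /flat_exp /flat_fun x0 hornerC mul1r expR_gt0. Qed.

Lemma flat_exp_le0 x : x <= 0 -> flat_exp x = 0.
Proof. by rewrite /flat_exp /flat_fun ltNge => ->. Qed.

Lemma smooth_flat_exp (V : normedModType R) (U : set V) (u : V -> R) :
  open U -> smooth_on U u -> smooth_on U (fun y => flat_exp (u y)).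
Proof.
move=> oU; pose D (P : {poly R}) := 'X^2 * (P - P^`()).
pose phi k := flat_fun (iter k D 1).
by apply: (@smooth_on_comp_real _ _ _ _ phi 0%N) => // i x; exact: is_derive_flat_fun.
Qed.

End flat.

(** * Smooth functions on manifolds *)

Section smooth_functions.
Context (R : realType) (V : normedModType R) (N : manifold V).
Implicit Types (U W : set N) (f g : N -> R).

Lemma chart_image_open (i : chart_idx N) U : open U ->
  open (chart i @` (U `&` chart_dom i)).
Proof.
move=> oU; apply: chart_open; last by move=> x [].
by apply: openI => //; exact: chart_dom_open.
Qed.

(** [smooth_fun_on] provides some local expression, possibly a different one for each open set;
    gluing needs a single one. This choice depends on f and the chart only, with value 0 off the
    image of the chart. *)
Definition local_rep f (i : chart_idx N) (v : V) : R :=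
  xget 0 [set r | exists x, [/\ chart_dom i x, chart i x = v & r = f x]].

Lemma local_repE f i x : chart_dom i x -> local_rep f i (chart i x) = f x.
Proof.
move=> ix; rewrite /local_rep.
case: xgetP => [r _ [y [iy yx ->]]|/(_ (f x)) []]; last by exists x.
by congr f; apply: (@chart_inj _ _ N i); rewrite ?inE.
Qed.

Lemma smooth_fun_onP U f : open U ->
  smooth_fun_on U f <->
  forall i, smooth_on (chart i @` (U `&` chart_dom i)) (local_rep f i).
Proof.
move=> oU; split=> sf i.
  have [g sg gE] := sf i; apply: smooth_on_ext sg; first exact: chart_image_open.
  by move=> _ /set_mem [x [Ux ix] <-]; rewrite -gE// local_repE.
by exists (local_rep f i) => // x _ ix; rewrite local_repE.
Qed.

Lemma smooth_fun_on_subset U W f :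
  W `<=` U -> smooth_fun_on U f -> smooth_fun_on W f.
Proof.
move=> sW sf i; have [g sg gE] := sf i; exists g; last first.
  by move=> x /sW; exact: gE.
by apply: smooth_on_subset sg => _ [x [/sW Ux ix] <-]; exists x.
Qed.

Lemma smooth_fun_on_ext U f g :
  (forall x, U x -> f x = g x) -> smooth_fun_on U f -> smooth_fun_on U g.
Proof.
move=> fg sf i; have [h sh hE] := sf i; exists h => // x Ux ix.
by rewrite -fg// hE.
Qed.

Lemma smooth_fun_on_local U f : open U ->
  (forall x, U x -> exists2 W, open_nbhs x W & smooth_fun_on W f) ->
  smooth_fun_on U f.
Proof.
move=> oU H; apply/smooth_fun_onP => // i k.
apply: Ck_on_local => _ [x [Ux ix] <-]; have [W [oW Wx] sf] := H x Ux.
exists (chart i @` (W `&` chart_dom i)).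
  by split; [exact: chart_image_open|exists x].
by exists (local_rep f i) => //; exact: (smooth_fun_onP f oW).1.
Qed.

Lemma smooth_fun_on_cst U (c : R) : smooth_fun_on U (fun=> c).
Proof. by move=> i; exists (fun=> c) => //; exact: smooth_on_cst. Qed.

Lemma smooth_fun_onD U f g : open U -> smooth_fun_on U f -> smooth_fun_on U g ->
  smooth_fun_on U (fun x => f x + g x).
Proof.
move=> oU sf sg i; have [f' sf' fE] := sf i; have [g' sg' gE] := sg i.
exists (fun v => f' v + g' v); last by move=> x Ux ix; rewrite fE// gE.
by apply: smooth_onD => //; exact: chart_image_open.
Qed.

Lemma smooth_fun_onM U f g : open U -> smooth_fun_on U f -> smooth_fun_on U g ->
  smooth_fun_on U (fun x => f x * g x).
Proof.
move=> oU sf sg i; have [f' sf' fE] := sf i; have [g' sg' gE] := sg i.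
exists (fun v => f' v * g' v); last by move=> x Ux ix; rewrite fE// gE.
by apply: smooth_onM => //; exact: chart_image_open.
Qed.

Lemma smooth_fun_on_sum (I : Type) (r : seq I) (F : I -> N -> R) U : open U ->
  (forall i, smooth_fun_on U (F i)) ->
  smooth_fun_on U (fun x => \sum_(i <- r) F i x).
Proof.
move=> oU sF; elim: r => [|i r IH].
  under eq_fun do rewrite big_nil; exact: smooth_fun_on_cst.
by under eq_fun do rewrite big_cons; apply: smooth_fun_onD.
Qed.

Lemma smooth_fun_on_prod (I : Type) (r : seq I) (F : I -> N -> R) U : open U ->
  (forall i, smooth_fun_on U (F i)) ->
  smooth_fun_on U (fun x => \prod_(i <- r) F i x).
Proof.
move=> oU sF; elim: r => [|i r IH].
  under eq_fun do rewrite big_nil; exact: smooth_fun_on_cst.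
by under eq_fun do rewrite big_cons; apply: smooth_fun_onM.
Qed.

Lemma smooth_fun_on_flat_exp U f : open U -> smooth_fun_on U f ->
  smooth_fun_on U (fun x => flat_exp (f x)).
Proof.
move=> oU sf i; have [f' sf' fE] := sf i.
exists (fun v => flat_exp (f' v)); last by move=> x Ux ix; rewrite fE.
by apply: smooth_flat_exp => //; exact: chart_image_open.
Qed.

(** On the part of D in U both factors are smooth, and on W the product vanishes. D is a parameter
    because the lemma serves both for global functions and for coefficients in another local
    frame. *)
Lemma smooth_fun_on_cutoff (chi f : N -> R) (D U W : set N) :
  open D -> open U -> open W -> smooth_fun_on D chi ->
  smooth_fun_on (D `&` U) f -> (forall x, W x -> chi x = 0) ->
  (forall x, U x \/ W x) -> smooth_fun_on D (fun x => chi x * f x).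
Proof.
move=> oD oU oW schi sf chi0 UW; apply: smooth_fun_on_local => // x Dx.
case: (UW x) => [Ux|Wx].
  have oDU : open (D `&` U) by exact: openI.
  exists (D `&` U) => //; apply: smooth_fun_onM => //.
  by apply: smooth_fun_on_subset schi => y [].
exists W => //; apply: (@smooth_fun_on_ext W (fun=> 0)).
  by move=> y Wy; rewrite chi0// mul0r.
exact: smooth_fun_on_cst.
Qed.

Lemma Cinf_cst (c : R) : @Cinf _ _ N (fun=> c).
Proof. exact: smooth_fun_on_cst. Qed.

Lemma CinfM f g : Cinf f -> Cinf g -> Cinf (fun x => f x * g x).
Proof. by move=> sf sg; apply: smooth_fun_onM => //; exact: openT. Qed.

End smooth_functions.

(** * Bump functions on manifolds *)

Section bump.
Context (R : realType) (n : nat) (M : manifold 'rV[R]_n).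

Definition row_coord (j : 'I_n) (v : 'rV[R]_n) : R := v ord0 j.

Lemma row_coord_linear j : linear (row_coord j).
Proof. by move=> a u v; rewrite /row_coord !mxE. Qed.

HB.instance Definition _ j := GRing.isLinear.Build R 'rV[R]_n R _
  (row_coord j) (row_coord_linear j).

Lemma smooth_chart_coord (i : chart_idx M) (j : 'I_n) :
  smooth_fun_on (chart_dom i) (fun x => chart i x ord0 j).
Proof.
move=> k; have [g sg gE] := @chart_smooth _ _ M k i.
exists (fun v => row_coord j (g v)); last by move=> x ix kx; rewrite /row_coord -(gE x).
rewrite setIC; apply: (@smooth_on_linear_comp _ _ _ _ _ g (row_coord j)) => //.
- by rewrite setIC; apply: chart_image_open; exact: chart_dom_open.
- exact: coord_continuous.
Qed.

Lemma chart_inv_nbhs (i : chart_idx M) (U : set M) (x : M) :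
  open U -> U x -> chart_dom i x ->
  exists2 r : R, 0 < r & forall v, `|v - chart i x| <= r ->
    exists2 y, U y /\ chart_dom i y & chart i y = v.
Proof.
move=> oU Ux ix; have oI := chart_image_open i oU.
have : nbhs (chart i x) (chart i @` (U `&` chart_dom i)).
  by apply: open_nbhs_nbhs; split => //; exists x.
move=> /nbhs_ballP[e /= e0 He]; exists (e / 2); first by rewrite divr_gt0.
move=> v vr; have [|y [Uy iy] <-] := He v; last by exists y.
rewrite -ball_normE /= distrC (le_lt_trans vr)//; lra.
Qed.

(** The closed ball of 'rV[R]_n is compact by finite dimension, and the set is its image under the
    inverse chart, which is continuous because charts are open maps. *)
Lemma compact_chart_ball (i : chart_idx M) (c : 'rV[R]_n) (r : R) :
  (forall v, `|v - c| <= r -> exists2 y, chart_dom i y & chart i y = v) ->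
  compact [set y | chart_dom i y /\ `|chart i y - c| <= r].
Proof.
move=> H; pose B := [set v : 'rV[R]_n | `|v - c| <= r].
have cB : compact B.
  apply: bounded_closed_compact.
    exists (`|c| + `|r|); split => // m mr v /= vr.
    rewrite -(subrK c v) (le_trans (ler_normD _ _))// addrC.
    by rewrite (le_trans _ (ltW mr))// lerD2l (le_trans vr)// ler_norm.
  rewrite (_ : B = closed_ball_ Num.norm c r); first exact: closed_closed_ball_.
  by apply/seteqP; split=> v; rewrite /B /closed_ball_ /= distrC.
(* A point is needed as default value of the inverse chart; without points the set is empty. *)
have [[x0]|noM] := pselect (inhabited M); last first.
  rewrite (_ : [set y | _] = set0); first exact: compact0.
  by rewrite -subset0 => y; case: noM; exact: inhabits y.
pose inv v : M := xget x0 [set y | chart_dom i y /\ chart i y = v].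
have invK y : chart_dom i y -> inv (chart i y) = y.
  move=> iy; rewrite /inv; case: xgetP => [z _ [iz zy]|/(_ y) []//].
  by apply: (@chart_inj _ _ M i); rewrite ?inE.
rewrite (_ : [set y | _] = inv @` B); last first.
  apply/seteqP; split=> [y [iy yr]|_ [v vB <-]].
    by exists (chart i y) => //; exact: invK.
  by have [y iy yv] := H v vB; rewrite -yv invK//= yv.
apply: continuous_compact => //; apply: continuous_in_subspaceT => v /set_mem vB.
have [y iy <-] := H v vB; rewrite /continuous_at invK// => W.
rewrite nbhsE => -[W' [oW' W'y] sW].
have : nbhs (chart i y) (chart i @` (W' `&` chart_dom i)).
  by apply: open_nbhs_nbhs; split; [exact: chart_image_open|exists y].
by apply: filterS => _ [z [W'z iz] <-]; apply: sW; rewrite invK.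
Qed.

(** The norm of 'rV[R]_n is the maximum of the entries, so the ball is a cube, off which a product
    of two factors exp(-1/x) per coordinate vanishes. Extension by 0 outside the chart is smooth
    since [K], compact in a Hausdorff space, is closed; its complement is the set [W] returned. *)
Lemma exists_bump (U : set M) (x : M) : open U -> U x ->
  exists2 chi : M -> R, Cinf chi /\ chi x = 1 &
    exists2 W, open W & (forall y, W y -> chi y = 0) /\ forall y, U y \/ W y.
Proof.
move=> oU Ux; have [i ix] := @chart_cover _ _ M x.
have [r r0 Hr] := chart_inv_nbhs oU Ux ix.
pose c := chart i x.
pose K := [set y | chart_dom i y /\ `|chart i y - c| <= r].
have KU : K `<=` U `&` chart_dom i.
  move=> y [iy yr]; have [z [Uz iz] zy] := Hr _ yr.
  by rewrite (_ : y = z)//; apply: (@chart_inj _ _ M i); rewrite ?inE.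
have cK : closed K.
  apply: compact_closed; first exact: manifold_hausdorff.
  by apply: compact_chart_ball => v /Hr[y [_ iy] yv]; exists y.
pose h y := \prod_(j < n) (flat_exp (r - (chart i y ord0 j - c ord0 j)) *
                           flat_exp (r + (chart i y ord0 j - c ord0 j))).
pose chi0 y := if `[< chart_dom i y >] then h y else 0.
have W0 y : ~ K y -> chi0 y = 0.
  rewrite /chi0; case: asboolP => // iy nK; apply/eqP/negP => hn0; apply: nK.
  split=> //; rewrite [`|_|]mx_normrE; apply/bigmax_leP; split; first exact: ltW.
  move=> [a j] _ /=; rewrite (ord1 a) !mxE.
  have : flat_exp (r - (chart i y ord0 j - c ord0 j)) *
         flat_exp (r + (chart i y ord0 j - c ord0 j)) != 0.
    by apply/negP => /eqP E; apply: hn0; rewrite /h (bigD1 j)//= E mul0r.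
  rewrite mulf_eq0 negb_or => /andP[a0 b0]; rewrite ler_norml; apply/andP; split.
    rewrite leNgt; apply/negP => H; move/eqP: b0; apply; apply: flat_exp_le0.
    by move: H; rewrite ltrNr => /ltW; rewrite -subr_le0 opprK addrC.
  rewrite leNgt; apply/negP => H; move/eqP: a0; apply; apply: flat_exp_le0.
  by rewrite subr_le0 ltW.
have chi0x : 0 < chi0 x.
  rewrite /chi0; case: asboolP => // _; apply: prodr_gt0 => j _.
  by rewrite subrr subr0 addr0 mulr_gt0 ?flat_exp_gt0.
have sj j : smooth_fun_on (chart_dom i) (fun y => chart i y ord0 j - c ord0 j).
  apply: smooth_fun_onD; [exact: chart_dom_open|exact: smooth_chart_coord|].
  exact: smooth_fun_on_cst.
have schi0 : Cinf chi0.
  apply: smooth_fun_on_local => [|y _]; first exact: openT.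
  have [Ky|nKy] := pselect (K y); last first.
    exists (~` K); first by split=> //; exact: closed_openC.
    by apply: smooth_fun_on_ext (@smooth_fun_on_cst _ _ M _ 0) => z /W0.
  have oi := @chart_dom_open _ _ M i.
  exists (chart_dom i); first by split=> //; have [] := Ky.
  apply: (@smooth_fun_on_ext _ _ _ _ h).
    by move=> z iz; rewrite /chi0; case: asboolP.
  apply: smooth_fun_on_prod => // j.
  apply: smooth_fun_onM => //; apply: smooth_fun_on_flat_exp => //;
    apply: smooth_fun_onD => //; try exact: smooth_fun_on_cst.
  apply: (@smooth_fun_on_ext _ _ _ _
      (fun y => (-1) * (chart i y ord0 j - c ord0 j))).
    by move=> z _; rewrite mulN1r.
  by apply: smooth_fun_onM => //; exact: smooth_fun_on_cst.
exists (fun y => (chi0 x)^-1 * chi0 y).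
  by split; [apply: CinfM => //; exact: Cinf_cst|rewrite mulVf// gt_eqF].
exists (~` K); first exact: closed_openC.
split=> [y /W0 ->|y]; first by rewrite mulr0.
by have [/KU[]|] := pselect (K y); [left|right].
Qed.

End bump.

(** * Sections and tensorial operators *)

Lemma linear_lfun (R : realType) (F G : vectType R) (f : F -> G) :
  linear f -> exists T : 'Hom(F, G), forall u, T u = f u.
Proof.
move=> lf; pose L := GRing.isLinear.Build R F G _ f lf.
pose f' : {linear F -> G} := HB.pack f L.
by exists (linfun f') => u; rewrite lfunE.
Qed.

Lemma coord_inj (R : realType) (F : vectType R) (u v : F) :
  (forall k, coord (vbasis {:F}) k u = coord (vbasis {:F}) k v) -> u = v.
Proof.
move=> uv; rewrite (coord_vbasis (memvf u)) (coord_vbasis (memvf v)).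
by apply: eq_bigr => k _; rewrite uv.
Qed.

Lemma coordZ (R : realType) (F : vectType R) m (b : m.-tuple F) k (c : R) u :
  coord b k (c *: u) = c * coord b k u.
Proof. exact: linearZ. Qed.

Lemma lfunZ (R : realType) (F G : vectType R) (f : 'Hom(F, G)) (c : R) u :
  f (c *: u) = c *: f u.
Proof. exact: linearZ. Qed.

Lemma lfunD (R : realType) (F G : vectType R) (f : 'Hom(F, G)) u v :
  f (u + v) = f u + f v.
Proof. exact: linearD. Qed.

Lemma coordD (R : realType) (F : vectType R) m (b : m.-tuple F) k u v :
  coord b k (u + v) = coord b k u + coord b k v.
Proof. exact: linearD. Qed.

Lemma coordN (R : realType) (F : vectType R) m (b : m.-tuple F) k u :
  coord b k (- u) = - coord b k u.
Proof. exact: linearN. Qed.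

(** Vector identities are checked on real coordinates, where [ring] applies. *)
Ltac vect_ring := apply: coord_inj => ?;
  rewrite ?(coordD, coordN, linear0, coordZ); ring.

Section sections.
Context (R : realType) (V : normedModType R) (N : manifold V) (E : vbundle N).
Implicit Types (s t : section E) (f : N -> R).

Lemma eq_section s t : (forall x, s x = t x) -> s = t.
Proof. by move=> st; apply: functional_extensionality_dep. Qed.

Lemma Gamma_lincomb f s t : Cinf f -> Gamma s -> Gamma t ->
  Gamma (fun x => f x *: s x + t x).
Proof.
move=> sf ss st i k; have oi := @frame_dom_open _ _ _ E i.
apply: (@smooth_fun_on_ext _ _ _ _ (fun x =>
  f x * coord (frame i x) k (s x) + coord (frame i x) k (t x))).
  by move=> x _; rewrite linearP.
apply: smooth_fun_onD => //; apply: smooth_fun_onM => //.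
exact: smooth_fun_on_subset sf.
Qed.

Lemma Gamma0 : @Gamma _ _ _ E (fun=> 0).
Proof.
move=> i k; apply: smooth_fun_on_ext (@smooth_fun_on_cst _ _ _ _ 0) => x _.
by rewrite linear0.
Qed.

Lemma GammaZ f s : Cinf f -> Gamma s -> Gamma (fun x => f x *: s x).
Proof.
move=> sf ss; have := Gamma_lincomb sf ss Gamma0; congr Gamma.
by apply: eq_section => x; rewrite addr0.
Qed.

Lemma GammaD s t : Gamma s -> Gamma t -> Gamma (fun x => s x + t x).
Proof.
move=> ss st; have := Gamma_lincomb (@Cinf_cst _ _ _ 1) ss st; congr Gamma.
by apply: eq_section => x; rewrite scale1r.
Qed.

Lemma Gamma_scale (c : R) s : Gamma s -> Gamma (fun x => c *: s x).
Proof. by move=> ss; apply: (@GammaZ (fun=> c)) => //; exact: Cinf_cst. Qed.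

Lemma Gamma_sum (I : Type) (r : seq I) (S : I -> section E) :
  (forall i, Gamma (S i)) -> Gamma (fun x => \sum_(i <- r) S i x).
Proof.
move=> sS; elim: r => [|i r IH].
  have -> : (fun x => \sum_(i <- [::]) S i x) = fun=> 0.
    by apply: eq_section => x; rewrite big_nil.
  exact: Gamma0.
have -> : (fun x => \sum_(j <- i :: r) S j x) =
    fun x => S i x + \sum_(j <- r) S j x.
  by apply: eq_section => x; rewrite big_cons.
exact: GammaD.
Qed.

Definition op_linear (P : section E -> section E) : Prop :=
  forall c s t, Gamma s -> Gamma t -> forall x,
    P (fun y => c *: s y + t y) x = c *: P s x + P t x.

Section op_linear.
Variable P : section E -> section E.
Hypothesis lP : op_linear P.

Lemma op_linear0 x : P (fun=> 0) x = 0.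
Proof.
have := lP 1 Gamma0 Gamma0 x.
rewrite (_ : (fun _ => _) = fun=> 0); last first.
  by apply: eq_section => y; rewrite scaler0 addr0.
by rewrite scale1r => /eqP; rewrite -subr_eq0 opprD addNKr oppr_eq0 => /eqP.
Qed.

Lemma op_linearD s t x : Gamma s -> Gamma t ->
  P (fun y => s y + t y) x = P s x + P t x.
Proof.
move=> ss st; have := lP 1 ss st x; rewrite scale1r => <-; congr (P _ x).
by apply: eq_section => y; rewrite scale1r.
Qed.

Lemma op_linearZ c s x : Gamma s -> P (fun y => c *: s y) x = c *: P s x.
Proof.
move=> ss; have := lP c ss Gamma0 x; rewrite op_linear0 addr0 => <-.
by congr (P _ x); apply: eq_section => y; rewrite addr0.
Qed.

Lemma op_linearN s x : Gamma s -> P (fun y => - s y) x = - P s x.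
Proof.
move=> ss; rewrite -scaleN1r -op_linearZ//; congr (P _ x).
by apply: eq_section => y; rewrite scaleN1r.
Qed.

Lemma op_linear_sum (I : Type) (r : seq I) (S : I -> section E) x :
  (forall i, Gamma (S i)) ->
  P (fun y => \sum_(i <- r) S i y) x = \sum_(i <- r) P (S i) x.
Proof.
move=> sS; elim: r => [|i r IH].
  rewrite big_nil -[RHS](op_linear0 x); congr (P _ x).
  by apply: eq_section => y; rewrite big_nil.
rewrite big_cons -IH -op_linearD//; last exact: Gamma_sum.
by congr (P _ x); apply: eq_section => y; rewrite big_cons.
Qed.

End op_linear.

End sections.

(** * Global sections from local frames *)

Section cutoff_frames.
Context (R : realType) (n : nat) (M : manifold 'rV[R]_n) (E : vbundle M).

(** The open set [cf_null] plays the part of the complement of the support of chi: together with the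
    domain of the frame it covers M, which is the form that [smooth_fun_on_cutoff] takes. *)
Record cutoff_frame (x : M) := CutoffFrame {
  cf_idx : frame_idx E;
  cf_fun : M -> R;
  cf_null : set M;
  cf_dom : frame_dom cf_idx x;
  cf_fun1 : cf_fun x = 1;
  cf_smooth : Cinf cf_fun;
  cf_null_open : open cf_null;
  cf_null0 : forall y, cf_null y -> cf_fun y = 0;
  cf_cover : forall y, frame_dom cf_idx y \/ cf_null y }.

Lemma exists_cutoff_frame (x : M) : inhabited (cutoff_frame x).
Proof.
have [i ix] := @frame_cover _ _ _ E x.
have [chi [schi chi1] [W oW [chi0 UW]]] :=
  exists_bump (@frame_dom_open _ _ _ E i) ix.
by split; exists i chi W.
Qed.

Section fixed_cutoff_frame.
Variables (x : M) (c : cutoff_frame x).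
Local Notation i := (cf_idx c).
Local Notation chi := (cf_fun c).
Local Notation m := (frame_rank i).

Definition cf_section (k : 'I_m) : section E :=
  fun y => chi y *: tnth (frame i y) k.

Definition cf_coord (k : 'I_m) (s : section E) : M -> R :=
  fun y => chi y * coord (frame i y) k (s y).

Lemma cf_sectionP k : Gamma (cf_section k).
Proof.
move=> j l; rewrite /cf_section; under eq_fun do rewrite linearZ.
apply: (@smooth_fun_on_cutoff _ _ _ _ _ _ (frame_dom i) (cf_null c)).
- exact: frame_dom_open.
- exact: frame_dom_open.
- exact: cf_null_open.
- by apply: smooth_fun_on_subset (cf_smooth c).
- exact: frame_smooth.
- exact: cf_null0.
- exact: cf_cover.
Qed.

Lemma cf_coordP k s : Gamma s -> Cinf (cf_coord k s).
Proof.
move=> ss.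
apply: (@smooth_fun_on_cutoff _ _ _ _ _ _ (frame_dom i) (cf_null c)).
- exact: openT.
- exact: frame_dom_open.
- exact: cf_null_open.
- exact: cf_smooth.
- by rewrite setTI; exact: ss.
- exact: cf_null0.
- exact: cf_cover.
Qed.

Lemma cf_expand s y :
  \sum_k cf_coord k s y *: cf_section k y = (chi y * chi y) *: s y.
Proof.
case: (cf_cover c y) => [iy|/cf_null0 chi0]; last first.
  rewrite chi0 mulr0 scale0r big1// => k _.
  by rewrite /cf_coord chi0 mul0r scale0r.
rewrite [in RHS](coord_basis (frame_basis iy) (memvf (s y))) scaler_sumr.
apply: eq_bigr => k _; rewrite /cf_coord /cf_section !scalerA (tnth_nth 0).
by congr (_ *: _); rewrite mulrAC.
Qed.

End fixed_cutoff_frame.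

Lemma Gamma_extend (x : M) (u : E x) : exists2 s : section E, Gamma s & s x = u.
Proof.
have [c] := exists_cutoff_frame x; have ix := cf_dom c.
exists (fun y => \sum_k coord (frame (cf_idx c) x) k u *: cf_section k y).
  by apply: Gamma_sum => k; apply: Gamma_scale; exact: cf_sectionP.
rewrite [RHS](coord_basis (frame_basis ix) (memvf u)); apply: eq_bigr => k _.
by rewrite /cf_section cf_fun1 scale1r (tnth_nth 0).
Qed.

Lemma endo_ofE (P : section E -> section E) (x : M) (T : 'End(E x)) :
  (forall s, Gamma s -> P s x = T (s x)) -> endo_of P x = T.
Proof.
move=> PT; rewrite /endo_of; case: xgetP => [T' _ T'P|/(_ T)]//.
by apply/lfunP => u; have [s ss <-] := Gamma_extend u; rewrite -T'P// PT.
Qed.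

Lemma tensorial_endo (P : section E -> section E) : op_linear P ->
  (forall f s, Cinf f -> Gamma s -> forall x,
    P (fun y => f y *: s y) x = f x *: P s x) ->
  forall s, Gamma s -> forall x, P s x = endo_of P x (s x).
Proof.
move=> lP fP s ss x; have [c] := exists_cutoff_frame x.
pose i := cf_idx c.
have [T TE] : exists T : 'End(E x),
    forall u, T u = \sum_k coord (frame i x) k u *: P (cf_section k) x.
  apply: linear_lfun => a u v; rewrite scaler_sumr -big_split.
  by apply: eq_bigr => k _; rewrite linearP scalerDl scalerA.
suff PT t : Gamma t -> P t x = T (t x) by rewrite (endo_ofE PT); exact: PT.
(* The scalar 1 is written as chi(x)^2, so that tensoriality moves the cutoff inside P. *)
move=> st; rewrite -[LHS]scale1r -[1](mulr1 1) -(cf_fun1 c).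
have schi := cf_smooth c.
rewrite -(fP (fun y => cf_fun c y * cf_fun c y))//; last exact: CinfM.
have -> : (fun y => (cf_fun c y * cf_fun c y) *: t y) =
    fun y => \sum_k cf_coord k t y *: cf_section (c := c) k y.
  by apply: eq_section => y; rewrite cf_expand.
rewrite op_linear_sum//; last first.
  by move=> k; apply: GammaZ; [exact: cf_coordP|exact: cf_sectionP].
rewrite TE; apply: eq_bigr => k _; rewrite fP.
- by rewrite /cf_coord cf_fun1 mul1r.
- exact: cf_coordP.
- exact: cf_sectionP.
Qed.

End cutoff_frames.

(** * Lie algebroids and connections *)

Section algebroid.
Context (R : realType) (n : nat) (M : manifold 'rV[R]_n) (A : lie_algebroid M).
Implicit Types (a b c : section A) (f g : M -> R).

Lemma bracket_op_linear a : Gamma a -> op_linear (bracket a).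
Proof.
move=> sa k s t ss st x; rewrite bracket_antisym//; last first.
  exact: (Gamma_lincomb (@Cinf_cst _ _ _ k)).
rewrite bracket_linear// opprD -scalerN -bracket_antisym//.
by rewrite -(bracket_antisym sa st).
Qed.

Lemma bracket0l b x : Gamma b -> bracket (fun=> 0 : A _) b x = 0.
Proof.
move=> sb; rewrite bracket_antisym//; last exact: Gamma0.
by rewrite (op_linear0 (bracket_op_linear sb)) oppr0.
Qed.

Lemma anchorZ (x : M) (k : R) (u : A x) f : Cinf f ->
  anchor (k *: u) f = k * anchor u f.
Proof.
move=> sf.
have a0 : anchor (0 : A x) f = 0.
  have := @anchor_linear _ _ _ A x 1 0 0 f sf.
  rewrite scaler0 addr0 mul1r => /eqP; rewrite -subr_eq0 opprD addNKr oppr_eq0.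
  by move=> /eqP.
by have := @anchor_linear _ _ _ A x k u 0 f sf; rewrite a0 !addr0.
Qed.

Lemma anchor0 (x : M) f : Cinf f -> anchor (0 : A x) f = 0.
Proof. by move=> sf; rewrite -(scale0r (0 : A x)) anchorZ// mul0r. Qed.

Lemma bracket_leibniz_fun a b f : Gamma a -> Gamma b -> Cinf f ->
  bracket a (fun y => f y *: b y) =
  fun y => f y *: bracket a b y + anchor (a y) f *: b y.
Proof. by move=> *; apply: eq_section => y; exact: bracket_leibniz. Qed.

Lemma bracket_jacobi_leibniz a b c x : Gamma a -> Gamma b -> Gamma c ->
  bracket (bracket a b) c x =
  bracket a (bracket b c) x - bracket b (bracket a c) x.
Proof.
move=> sa sb sc; have J := bracket_jacobi sa sb sc x.
have sab := bracket_smooth sa sb.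
have sac := bracket_smooth sa sc.
rewrite bracket_antisym// -[LHS]add0r -J addrK.
rewrite -(op_linearN (bracket_op_linear sb))//.
congr (_ + _); congr (bracket _ _ x).
by apply: eq_section => y; rewrite bracket_antisym.
Qed.

(* For the fibre A_x != 0 this is the Jacobi identity for a, b and f c; where
   A_x = 0 both sides vanish. *)
Lemma anchor_bracket a b f x : Gamma a -> Gamma b -> Cinf f ->
  anchor (bracket a b x) f =
  anchor (a x) (fun y => anchor (b y) f) - anchor (b x) (fun y => anchor (a y) f).
Proof.
move=> sa sb sf.
have sbf := anchor_smooth sb sf; have saf := anchor_smooth sa sf.
have [A0|nA0] := pselect (forall u : A x, u = 0).
  by rewrite (A0 (bracket a b x)) (A0 (a x)) (A0 (b x)) !anchor0// subr0.
have [u u0] : exists u : A x, u <> 0.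
  by apply: contrapT => H; apply: nA0 => u; apply: contrapT => u0; apply: H; exists u.
have [c sc cu] := Gamma_extend u.
have sab := bracket_smooth sa sb; have sac := bracket_smooth sa sc.
have sbc := bracket_smooth sb sc.
have sfc := GammaZ sf sc.
have := bracket_jacobi_leibniz x sa sb sfc.
rewrite (bracket_leibniz_fun sa sc sf) (bracket_leibniz_fun sb sc sf).
rewrite bracket_leibniz//.
rewrite !op_linearD; try exact: bracket_op_linear; try exact: GammaZ.
rewrite !bracket_leibniz// bracket_jacobi_leibniz//.
set p := bracket a (bracket b c) x; set q := bracket b (bracket a c) x.
move/eqP; rewrite -subr_eq0 => /eqP H.
have : (anchor (bracket a b x) f -
  (anchor (a x) (fun y => anchor (b y) f) -
   anchor (b x) (fun y => anchor (a y) f))) *: c x = 0.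
  rewrite -[RHS]H !scalerBl scalerBr !opprD !opprK.
  vect_ring.
move/eqP; rewrite scaler_eq0 cu => /orP[|/eqP//].
by rewrite subr_eq0 => /eqP.
Qed.

End algebroid.

Section endomorphism_sections.
Context (R : realType) (V : normedModType R) (N : manifold V) (E : vbundle N).

Lemma GammaEnd_apply (T : endo E) (s : section E) :
  GammaEnd T -> Gamma s -> Gamma (fun x => T x (s x)).
Proof.
move=> sT ss i k.
apply: (@smooth_fun_on_ext _ _ _ _ (fun x => \sum_l
  coord (frame i x) l (s x) * coord (frame i x) k (T x (tnth (frame i x) l)))).
  move=> x ix; rewrite [in RHS](coord_basis (frame_basis ix) (memvf (s x))).
  rewrite linear_sum linear_sum; apply: eq_bigr => l _.
  by rewrite /= lfunZ coordZ (tnth_nth 0).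
apply: smooth_fun_on_sum; first exact: frame_dom_open.
by move=> l; apply: smooth_fun_onM; [exact: frame_dom_open|exact: ss|exact: sT].
Qed.

End endomorphism_sections.

Section connections.
Context (R : realType) (n : nat) (M : manifold 'rV[R]_n).
Context (A : lie_algebroid M) (E : vbundle M).
Implicit Types (a b : section A) (s : section E) (f : M -> R).
Local Notation br := (@bracket _ _ _ A).

Section one_connection.
Variable D : section A -> section E -> section E.
Hypothesis cD : connection D.

Lemma conn_smooth a s : Gamma a -> Gamma s -> Gamma (D a s).
Proof. by move=> sa ss; have [/(_ a sa) [+ _ _] _ _] := cD; exact. Qed.

Lemma conn_op_linear a : Gamma a -> op_linear (D a).
Proof. by move=> sa; have [/(_ a sa) [_ + _] _ _] := cD. Qed.

Lemma conn_leibniz a f s x : Gamma a -> Cinf f -> Gamma s ->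
  D a (fun y => f y *: s y) x = f x *: D a s x + anchor (a x) f *: s x.
Proof. by move=> sa sf ss; have [_ /(_ a sa) + _] := cD; exact. Qed.

Lemma conn_leibniz_fun a f s : Gamma a -> Cinf f -> Gamma s ->
  D a (fun y => f y *: s y) =
  fun y => f y *: D a s y + anchor (a y) f *: s y.
Proof. by move=> *; apply: eq_section => y; exact: conn_leibniz. Qed.

Lemma conn_linear (c : R) a b s x : Gamma a -> Gamma b -> Gamma s ->
  D (fun y => c *: a y + b y) s x = c *: D a s x + D b s x.
Proof. by move=> *; have [_ _] := cD; exact. Qed.

Lemma conn0 s x : Gamma s -> D (fun=> 0 : A _) s x = 0.
Proof.
move=> ss; have := @conn_linear 1 _ _ s x (@Gamma0 _ _ _ A) (@Gamma0 _ _ _ A) ss.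
rewrite (_ : (fun _ => _ + _) = fun=> 0); last first.
  by apply: eq_section => y; rewrite scaler0 addr0.
by rewrite scale1r => /eqP; rewrite -subr_eq0 opprD addNKr oppr_eq0 => /eqP.
Qed.

Lemma curvature_op_linear a b : Gamma a -> Gamma b ->
  op_linear (curvature br D a b).
Proof.
move=> sa sb c s t ss st x; rewrite /curvature.
have sab := bracket_smooth sa sb.
have E1 a' : Gamma a' -> D a' (fun y => c *: s y + t y) =
    fun y => c *: D a' s y + D a' t y.
  by move=> sa'; apply: eq_section => y; exact: conn_op_linear.
rewrite !E1// !(conn_op_linear _ _)//; try exact: conn_smooth.
vect_ring.
Qed.

(** The terms that pair a derivative of f with a derivative of s cancel in the commutator; those
    with second derivatives of f cancel by [anchor_bracket]. *)
Lemma curvature_tensorial a b f s x : Gamma a -> Gamma b -> Cinf f -> Gamma s ->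
  curvature br D a b (fun y => f y *: s y) x = f x *: curvature br D a b s x.
Proof.
move=> sa sb sf ss; rewrite /curvature.
have sab := bracket_smooth sa sb.
have saf := anchor_smooth sa sf; have sbf := anchor_smooth sb sf.
have sas := conn_smooth sa ss; have sbs := conn_smooth sb ss.
rewrite !conn_leibniz_fun//.
rewrite !(op_linearD (conn_op_linear _))//; try exact: GammaZ.
rewrite !conn_leibniz// anchor_bracket//.
vect_ring.
Qed.

Lemma curvature_endo a b s x : Gamma a -> Gamma b -> Gamma s ->
  curvature br D a b s x = endo_of (curvature br D a b) x (s x).
Proof.
move=> sa sb ss; apply: tensorial_endo => //; first exact: curvature_op_linear.
by move=> f t sf st y; exact: curvature_tensorial.
Qed.

Lemma curvature_antisym a b s x : Gamma a -> Gamma b -> Gamma s ->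
  curvature br D b a s x = - curvature br D a b s x.
Proof.
move=> sa sb ss; rewrite /curvature.
have -> : br b a = fun y => (-1) *: br a b y + 0.
  by apply: eq_section => y; rewrite bracket_antisym// scaleN1r addr0.
rewrite conn_linear//; [|exact: bracket_smooth|exact: Gamma0].
rewrite conn0//; vect_ring.
Qed.

Lemma conn_End_endo a (T : endo E) s x : Gamma a -> GammaEnd T -> Gamma s ->
  D a (fun y => T y (s y)) x - T x (D a s x) = conn_End D a T x (s x).
Proof.
move=> sa sT ss.
apply: (tensorial_endo (P := fun s x => D a (fun y => T y (s y)) x - T x (D a s x))) => //.
  move=> c s' t ss' st y; rewrite (conn_op_linear sa)//.
  have -> : (fun y => T y (c *: s' y + t y)) =
      fun y => c *: T y (s' y) + T y (t y).
    by apply: eq_section => z; rewrite lfunD lfunZ.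
  rewrite (conn_op_linear sa); try exact: GammaEnd_apply.
  rewrite lfunD lfunZ; vect_ring.
move=> f t sf st y.
have -> : (fun y => T y (f y *: t y)) = fun y => f y *: T y (t y).
  by apply: eq_section => z; rewrite lfunZ.
rewrite !conn_leibniz//; last exact: GammaEnd_apply.
rewrite lfunD !lfunZ; vect_ring.
Qed.

End one_connection.

Section one_form.
Variable theta : End_form A E 1.
Hypothesis atheta : alt_form theta.

Lemma form1_smooth a : Gamma a -> GammaEnd (theta (fun=> a)).
Proof. by move=> sa; have [+ _ _] := atheta; exact. Qed.

Lemma form1_linear (c : R) a b x : Gamma a -> Gamma b ->
  theta (fun=> fun y => c *: a y + b y) x =
  c *: theta (fun=> a) x + theta (fun=> b) x.
Proof.
move=> sa sb; have [_ + _] := atheta.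
move=> /(_ (fun=> a) ord0 c a b (fun=> sa) sa sb x).
have E1 u : (fun j : 'I_1 => if j == ord0 then u else a) = fun=> u.
  by apply/funext => j; rewrite (ord1 j).
by rewrite !E1.
Qed.

Lemma form1_0 x : theta (fun=> fun=> 0) x = 0.
Proof.
have := form1_linear 1 x (@Gamma0 _ _ _ A) (@Gamma0 _ _ _ A).
rewrite (_ : (fun _ => _ + _) = fun=> 0); last first.
  by apply: eq_section => y; rewrite scaler0 addr0.
by rewrite scale1r => /eqP; rewrite -subr_eq0 opprD addNKr oppr_eq0 => /eqP.
Qed.

Lemma form1N a x : Gamma a ->
  theta (fun=> fun y => - a y) x = - theta (fun=> a) x.
Proof.
move=> sa; have := form1_linear (-1) x sa (@Gamma0 _ _ _ A).
rewrite form1_0 addr0 scaleN1r => <-; congr (theta _ x); apply/funext => _.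
by apply: eq_section => y; rewrite scaleN1r addr0.
Qed.

Variable D : section A -> section E -> section E.
Hypothesis cD : connection D.

Definition conn_path (t : R) a s : section E :=
  fun x => D a s x + t *: theta (fun=> a) x (s x).

Lemma conn_path_smooth t a s : Gamma a -> Gamma s -> Gamma (conn_path t a s).
Proof.
move=> sa ss; apply: GammaD; first exact: conn_smooth.
by apply: Gamma_scale; apply: GammaEnd_apply => //; exact: form1_smooth.
Qed.

(** Each theta(a) commutes with functions, so adding it leaves the symbol unchanged. [symE] is an
    equivalence because both existence and uniqueness of the vector field have to be transferred. *)
Lemma connection_conn_add : connection (conn_add D theta).
Proof.
split.
- move=> a sa; have [/(_ a sa) [_ _ [X [vX DX X1]]] sy _] := cD.
  have symE Y : has_symbol (conn_add D theta a) Y <-> has_symbol (D a) Y.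
    split=> H f s sf ss x; have := H f s sf ss x; rewrite /conn_add lfunZ.
      move=> /eqP; rewrite -subr_eq0 => /eqP H'.
      by apply/eqP; rewrite -subr_eq0 -H'; apply/eqP; vect_ring.
    by move=> ->; vect_ring.
  split.
  + move=> s ss; apply: GammaD; first exact: conn_smooth.
    by apply: GammaEnd_apply => //; exact: form1_smooth.
  + move=> c s t ss st x; rewrite /conn_add (conn_op_linear cD sa)// lfunD lfunZ.
    vect_ring.
  + exists X; split=> //; first exact/symE.
    by move=> Y vY /symE; exact: X1.
- move=> a sa f s sf ss x; rewrite /conn_add (conn_leibniz cD)// lfunZ.
  vect_ring.
- move=> c a b s sa sb ss x; rewrite /conn_add (conn_linear cD)// form1_linear//.
  rewrite add_lfunE scale_lfunE; vect_ring.
Qed.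

Definition comm_lfun (F : vectType R) (S T : 'End(F)) : 'End(F) :=
  (S \o T)%VF - (T \o S)%VF.

(** In the expanded commutator the terms linear in t are [D_a, theta(b)] - [D_b, theta(a)] -
    theta([a, b]), which is [d_End]; those in t^2 form the commutator of theta(a) and theta(b). *)
Lemma curvature_conn_path t a b s x : Gamma a -> Gamma b -> Gamma s ->
  curvature br (conn_path t) a b s x =
  (endo_of (curvature br D a b) x +
   t *: d_End D theta (fun j => if j == ord0 then a else b) x +
   (t * t) *: comm_lfun (theta (fun=> a) x) (theta (fun=> b) x)) (s x).
Proof.
move=> sa sb ss; rewrite !add_lfunE !scale_lfunE -(curvature_endo cD)//.
have sTa := form1_smooth sa; have sTb := form1_smooth sb.
have sTas := GammaEnd_apply sTa ss; have sTbs := GammaEnd_apply sTb ss.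
rewrite /d_End /comm_lfun !add_lfunE !opp_lfunE !comp_lfunE /=.
rewrite -!(conn_End_endo cD)//.
rewrite /curvature /conn_path.
rewrite !(op_linearD (conn_op_linear cD _))//; try exact: (conn_smooth cD);
  try exact: Gamma_scale.
rewrite !(op_linearZ (conn_op_linear cD _))//.
rewrite !lfunD !lfunZ; vect_ring.
Qed.

End one_form.

End connections.

(** * Sections over the product with the line *)

Section curves.
Context (R : realType).
Implicit Types (F : vectType R).

(** [fibre_derive] has a value for every curve; the predicate adds derivability, without which sum
    and product rules fail. *)
Definition is_fibre_derive F (u : R -> F) (t : R) (w : F) : Prop :=
  forall k, is_derive t 1 (fun s => coord (vbasis {:F}) k (u s))
                          (coord (vbasis {:F}) k w).

Lemma is_fibre_deriveE F (u : R -> F) t w :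
  is_fibre_derive u t w -> fibre_derive u t = w.
Proof.
move=> uw; rewrite [RHS](coord_vbasis (memvf w)); apply: eq_bigr => k _.
by rewrite derive1E; have [_ ->] := uw k; rewrite (tnth_nth 0).
Qed.

Lemma is_fibre_deriveD F (u1 u2 : R -> F) t w1 w2 :
  is_fibre_derive u1 t w1 -> is_fibre_derive u2 t w2 ->
  is_fibre_derive (fun s => u1 s + u2 s) t (w1 + w2).
Proof.
move=> d1 d2 k; rewrite coordD; under eq_fun do rewrite coordD.
exact: is_deriveD (d1 k) (d2 k).
Qed.

Lemma is_fibre_derive_cst F (v : F) t : is_fibre_derive (fun=> v) t 0.
Proof. by move=> k; rewrite linear0; exact: is_derive_cst. Qed.

Lemma is_fibre_derive_sum F (I : Type) (r : seq I) (u : I -> R -> F) t w :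
  (forall i, is_fibre_derive (u i) t (w i)) ->
  is_fibre_derive (fun s => \sum_(i <- r) u i s) t (\sum_(i <- r) w i).
Proof.
move=> d; elim: r => [|i r IH].
  rewrite big_nil; under eq_fun do rewrite big_nil; exact: is_fibre_derive_cst.
rewrite big_cons; under eq_fun do rewrite big_cons.
exact: is_fibre_deriveD.
Qed.

Lemma is_fibre_deriveZ F (g : R -> R) (u : R -> F) (t g' : R) w :
  is_derive t 1 g g' -> is_fibre_derive u t w ->
  is_fibre_derive (fun s => g s *: u s) t (g' *: u t + g t *: w).
Proof.
move=> dg du k; under eq_fun do rewrite coordZ.
apply: is_derive_eq (is_deriveM dg (du k)) _.
rewrite coordD !coordZ addrC; congr (_ + _); exact: mulrC.
Qed.

Lemma is_fibre_deriveZl F (g : R -> R) (v : F) (t g' : R) :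
  is_derive t 1 g g' -> is_fibre_derive (fun s => g s *: v) t (g' *: v).
Proof.
move=> dg; rewrite -[_ *: v]addr0 -(scaler0 _ (g t)).
exact: is_fibre_deriveZ dg (is_fibre_derive_cst v t).
Qed.

Lemma is_fibre_deriveZr F (c : R) (u : R -> F) t w :
  is_fibre_derive u t w -> is_fibre_derive (fun s => c *: u s) t (c *: w).
Proof.
move=> du; rewrite -[_ *: w]add0r -(scale0r (u t)).
by apply: is_fibre_deriveZ du; exact: is_derive_cst.
Qed.

Lemma is_fibre_derive_lfun F (G : vectType R) (T : 'Hom(F, G)) (u : R -> F) t w :
  is_fibre_derive u t w -> is_fibre_derive (fun s => T (u s)) t (T w).
Proof.
move=> du.
have TE v : T v = \sum_k coord (vbasis {:F}) k v *: T (vbasis {:F})`_k.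
  rewrite {1}(coord_vbasis (memvf v)) linear_sum.
  by apply: eq_bigr => k _; rewrite /= lfunZ.
rewrite TE; under eq_fun do rewrite TE.
by apply: is_fibre_derive_sum => k; exact: is_fibre_deriveZl.
Qed.

End curves.

Section line.
Context (R : realType) (V : normedModType R) (M : manifold V).
Local Notation L := (line_prod M).

Lemma is_derive_slicel (V1 V2 W : normedModType R) (f : V1 * V2 -> W) s x w :
  derivable f (s, x) (w, 0) ->
  is_derive s w (fun y => f (y, x)) ('D_(w, 0) f (s, x)).
Proof.
move=> df; apply: DeriveDef; last exact: derive_slicel.
rewrite /derivable; set G := (G in cvg (G @ _)).
suff -> : G = fun h : R => h^-1 *: ((f \o shift (s, x)) (h *: (w, 0)) - f (s, x)).
  exact: df.
apply/funext => h; rewrite /G /=; congr (_ *: (f _ - _)).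
by apply: injective_projections; rewrite /= ?scaler0 ?add0r.
Qed.

Definition dt (F : L -> R) : L -> R := fun p => (fun s => F (s, p.2))^`()%classic p.1.

Definition line_set (U : set M) : set L := [set p | U p.2].

Lemma line_chart_image (U : set M) (i : chart_idx M) (t : R) (x : M) :
  U x -> chart_dom i x ->
  (@chart _ _ L i @` (line_set U `&` @chart_dom _ _ L i)) (t, chart i x).
Proof. by move=> Ux ix; exists (t, x). Qed.

Lemma line_set_open (U : set M) : open U -> open (line_set U).
Proof.
move=> oU; rewrite (_ : line_set U = setT `*` U); first exact/open_prod/oU/openT.
by apply/seteqP; split=> p //= [].
Qed.

Variable U : set M.
Hypothesis oU : open U.

Lemma smooth_fun_on_slice (F : L -> R) (t : R) :
  smooth_fun_on (line_set U) F -> smooth_fun_on U (fun y => F (t, y)).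
Proof.
move=> sF i; have [g sg gE] := sF i; exists (fun v => g (t, v)).
  apply: smooth_on_subset (smooth_on_slice t sg) => _ [x [Ux ix] <-].
  exact: line_chart_image.
by move=> x Ux ix; rewrite gE.
Qed.

(** The charts of R x M are the identity on the factor R, so d/dt is the direction (1, 0) in each of
    them. *)
Lemma dt_local_rep (F : L -> R) (i : chart_idx M) g
    (t : R) x :
  (forall p, line_set U p -> @chart_dom _ _ L i p -> F p = g (@chart _ _ L i p)) ->
  smooth_on (@chart _ _ L i @` (line_set U `&` @chart_dom _ _ L i)) g ->
  U x -> chart_dom i x ->
  is_derive t 1 (fun s => F (s, x)) ('D_(1, 0) g (t, chart i x)).
Proof.
move=> gE sg Ux ix; have -> : (fun s => F (s, x)) = fun s => g (s, chart i x).
  by apply/funext => s; rewrite gE.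
apply: is_derive_slicel.
exact: (smooth_on_derivable sg (line_chart_image _ Ux ix)).
Qed.

Lemma is_derive_dt (F : L -> R) (t : R) x : smooth_fun_on (line_set U) F -> U x ->
  is_derive t 1 (fun s => F (s, x)) (dt F (t, x)).
Proof.
move=> sF Ux; have [i ix] := @chart_cover _ _ M x; have [g sg gE] := sF i.
have d := dt_local_rep t gE sg Ux ix; rewrite /dt /= derive1E.
by apply: derivableP; have [] := d.
Qed.

Lemma smooth_fun_on_dt (F : L -> R) :
  smooth_fun_on (line_set U) F -> smooth_fun_on (line_set U) (dt F).
Proof.
move=> sF i; have [g sg gE] := sF i; exists (fun v => 'D_(1, 0) g v).
  exact: smooth_on_derive.
move=> [t x] Ux ix; have [_ <-] := dt_local_rep t gE sg Ux ix.
by rewrite /dt derive1E.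
Qed.

End line.

(** In a chart v is the derivative along some w, so the claim exchanges the directions (1, 0) and
    (0, w): an instance of [derive_mixed]. *)
Lemma is_derive_tangent (R : realType) (V : normedModType R) (M : manifold V)
    (F : line_prod M -> R) (x : M) (v : (M -> R) -> R) (t : R) :
  Cinf F -> tangent x v ->
  is_derive t 1 (fun s => v (fun y => F (s, y))) (v (fun y => dt F (t, y))).
Proof.
move=> sF [i [w [ix vE]]].
have sT : line_set [set: M] = setT by apply/seteqP.
have sF' : smooth_fun_on (line_set [set: M]) F by rewrite sT.
have [g sg gE] := sF' i.
have sl s (h : R * V -> R) : smooth_on (@chart _ _ (line_prod M) i @`
      (line_set [set: M] `&` @chart_dom _ _ (line_prod M) i)) h ->
    smooth_on (chart i @` chart_dom i) (fun v => h (s, v)).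
  move=> sh; apply: smooth_on_subset (smooth_on_slice s sh) => _ [y iy <-].
  exact: line_chart_image.
have sdg := smooth_on_derive ((1, 0) : R * V) sg.
have E s : v (fun y => F (s, y)) = 'D_(0, w) g (s, chart i x).
  rewrite (vE _ (fun v => g (s, v))).
  - by rewrite derive_slice.
  - exact: smooth_fun_on_slice sF'.
  - exact: sl.
  - by move=> y iy; rewrite gE.
have -> : v (fun y => dt F (t, y)) = 'D_(0, w) (fun p => 'D_(1, 0) g p) (t, chart i x).
  rewrite (vE _ (fun v => 'D_(1, 0) g (t, v))).
  - exact: (@derive_slice _ _ _ _ (fun p => 'D_(1, 0) g p) t).
  - by apply: smooth_fun_on_slice; exact: smooth_fun_on_dt.
  - exact: (sl t _ sdg).
  - move=> y iy; have [_ <-] := dt_local_rep t gE sg I iy.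
    by rewrite /dt derive1E.
have oL := @chart_image_open _ _ (line_prod M) i _ (line_set_open (@openT M)).
have Ux := line_chart_image t (I : [set: M] x) ix.
under eq_fun do rewrite E.
rewrite (derive_mixed _ _ oL Ux sg).
apply: is_derive_slicel.
exact: smooth_on_derivable (smooth_on_derive ((0, w) : R * V) sg) Ux.
Qed.

Section pullback_sections.
Context (R : realType) (n : nat) (M : manifold 'rV[R]_n) (E : vbundle M).
Implicit Types (mu : section (pullback_line E)).

Definition slice mu (t : R) : section E := fun x => mu (t, x).

Definition dslice mu (t : R) : section E :=
  fun x => fibre_derive (fun s => slice mu s x) t.

Lemma Gamma_slice mu t : Gamma mu -> Gamma (slice mu t).
Proof.
move=> smu i k.
exact: (@smooth_fun_on_slice _ _ _ _
  (fun p => coord (frame i p.2) k (mu p)) t (smu i k)).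
Qed.

Lemma Gamma_pullback (s : section E) :
  Gamma s -> Gamma (fun p => s p.2 : pullback_line E p).
Proof. by move=> ss i k; exact: (smooth_pullback (ss i k)). Qed.

Lemma pullback_extend (p : line_prod M) (u : E p.2) :
  exists2 mu : section (pullback_line E), Gamma mu & mu p = u.
Proof.
have [s ss su] := Gamma_extend u.
by exists (fun p => s p.2) => //; exact: Gamma_pullback.
Qed.

(** Smoothness of mu is known in frame coordinates, whereas fibre derivatives use those of [vbasis];
    the frame vectors at x do not move with t, which links the two. *)
Lemma is_fibre_derive_frame mu t x i : Gamma mu -> frame_dom i x ->
  is_fibre_derive (fun s => slice mu s x) t (\sum_k
    dt (fun p => coord (frame i p.2) k (mu p)) (t, x) *: tnth (frame i x) k).
Proof.
move=> smu ix.
have muE s : slice mu s x =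
    \sum_k coord (frame i x) k (slice mu s x) *: tnth (frame i x) k.
  rewrite [LHS](coord_basis (frame_basis ix) (memvf (slice mu s x))).
  by apply: eq_bigr => k _; rewrite (tnth_nth 0).
under [in X in is_fibre_derive X]eq_fun do rewrite muE.
apply: is_fibre_derive_sum => k; apply: is_fibre_deriveZl.
exact: (@is_derive_dt _ _ _ (frame_dom i)
  (fun p => coord (frame i p.2) k (mu p)) t x (smu i k) ix).
Qed.

Lemma is_fibre_derive_slice mu t x : Gamma mu ->
  is_fibre_derive (fun s => slice mu s x) t (dslice mu t x).
Proof.
move=> smu; have [i ix] := frame_cover E x.
by have d := is_fibre_derive_frame t smu ix; rewrite /dslice (is_fibre_deriveE d).
Qed.

Lemma coord_dslice mu t x i k : Gamma mu -> frame_dom i x ->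
  coord (frame i x) k (dslice mu t x) =
  dt (fun p => coord (frame i p.2) k (mu p)) (t, x).
Proof.
move=> smu ix; rewrite /dslice (is_fibre_deriveE (is_fibre_derive_frame t smu ix)).
have /andP[_ fr] := frame_basis ix.
under eq_bigr do rewrite (tnth_nth 0).
by rewrite coord_sum_free.
Qed.

Lemma Gamma_dslice mu t : Gamma mu -> Gamma (dslice mu t).
Proof.
move=> smu i k.
apply: (@smooth_fun_on_ext _ _ _ _
    (fun x => dt (fun p => coord (frame i p.2) k (mu p)) (t, x))).
  by move=> x ix; rewrite coord_dslice.
by apply: smooth_fun_on_slice; apply: smooth_fun_on_dt; exact: smu.
Qed.

(* Both sides are expanded in a cutoff frame; on the coefficients the claim is
   the symmetry of mixed partial derivatives. *)
Lemma is_fibre_derive_conn (A : lie_algebroid M)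
    (D : section A -> section E -> section E) (a : section A) mu t x :
  connection D -> Gamma a -> Gamma mu ->
  is_fibre_derive (fun s => D a (slice mu s) x) t (D a (dslice mu t) x).
Proof.
move=> cD sa smu; have [c] := @exists_cutoff_frame _ _ _ E x.
pose chi := cf_fun c; have schi : Cinf chi := cf_smooth c.
have schi2 : Cinf (fun y => chi y * chi y) by exact: CinfM.
pose K := frame_rank (cf_idx c).
pose e (k : 'I_K) : section E := cf_section (c := c) k.
pose X (f : M -> R) := anchor (a x) f.
(* The Leibniz rule for chi^2 s, solved for [D a s x] at the point where chi = 1; the last term
   compensates the derivative of chi^2. *)
have DE s : Gamma s -> D a s x =
    \sum_k (cf_coord (c := c) k s x *: D a (e k) x + X (cf_coord (c := c) k s) *: e k x)
    + (- X (fun y => chi y * chi y)) *: s x.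
  move=> ss; have := conn_leibniz cD x sa schi2 ss.
  have -> : (fun y => (chi y * chi y) *: s y) =
      fun y => \sum_k cf_coord k s y *: cf_section (c := c) k y.
    by apply: eq_section => y; rewrite cf_expand.
  rewrite (op_linear_sum (conn_op_linear cD sa)); last first.
    by move=> k; apply: GammaZ; [exact: cf_coordP|exact: cf_sectionP].
  have chi1 : chi x = 1 := cf_fun1 c.
  rewrite /= chi1 mulr1 scale1r => H.
  apply: (addIr (X (fun y => chi y * chi y) *: s x)).
  rewrite scaleNr subrK -H; apply: eq_bigr => k _; rewrite (conn_leibniz cD)//.
    exact: cf_coordP.
  exact: cf_sectionP.
pose F k : line_prod M -> R := fun p =>
  chi p.2 * coord (frame (cf_idx c) p.2) k (mu p).
have sF k : Cinf (F k).
  apply: (@smooth_fun_on_cutoff _ _ (line_prod M) (fun p => chi p.2)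
    (fun p => coord (frame (cf_idx c) p.2) k (mu p))
    setT (line_set (frame_dom (cf_idx c))) (line_set (cf_null c))).
  - exact: openT.
  - by apply: line_set_open; exact: frame_dom_open.
  - by apply: line_set_open; exact: cf_null_open.
  - exact: (smooth_pullback schi).
  - by rewrite setTI; exact: smu.
  - by move=> p; exact: cf_null0.
  - by move=> p; exact: cf_cover.
have cF k s : cf_coord (c := c) k (slice mu s) = fun y => F k (s, y).
  by [].
have cdF k : cf_coord (c := c) k (dslice mu t) = fun y => dt (F k) (t, y).
  apply/funext => y; rewrite /cf_coord /dt /F /=.
  have [iy|/cf_null0 c0] := cf_cover c y; last first.
    rewrite c0 mul0r; under eq_fun do rewrite /chi c0 mul0r.
    by rewrite derive1_cst.
  rewrite coord_dslice// derive1E.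
  have d := @is_derive_dt _ _ _ (frame_dom (cf_idx c))
    (fun p => coord (frame (cf_idx c) p.2) k (mu p)) t y (smu _ k) iy.
  by have [_ ->] := is_deriveZ (chi y) d.
rewrite (DE _ (Gamma_dslice t smu)).
under [in X in is_fibre_derive X]eq_fun do rewrite (DE _ (Gamma_slice _ smu)).
apply: is_fibre_deriveD.
  apply: is_fibre_derive_sum => k; rewrite cdF.
  under [in X in is_fibre_derive X]eq_fun do rewrite cF.
  apply: is_fibre_deriveD; apply: is_fibre_deriveZl.
    have sF' : smooth_fun_on (line_set [set: M]) (F k).
      have sT : line_set [set: M] = setT by apply/seteqP.
      by rewrite sT; exact: sF.
    exact: is_derive_dt sF' _.
  exact: (is_derive_tangent t (sF k) (anchor_tangent (a x))).
by apply: is_fibre_deriveZr; exact: is_fibre_derive_slice.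
Qed.

End pullback_sections.

(** * Curvature of the affine combination *)

Section affine_combination.
Context (R : realType) (n : nat) (M : manifold 'rV[R]_n).
Context (A : lie_algebroid M) (E : vbundle M).
Variables (D : section A -> section E -> section E) (theta : End_form A E 1).
Hypotheses (cD : connection D) (atheta : alt_form theta).
Implicit Types (a b : section A) (mu : section (pullback_line E)).
Local Notation br := (@bracket _ _ _ A).
Local Notation abr := (@aff_bracket _ _ _ A).
Local Notation aff := (aff_conn D (conn_add D theta)).
Local Notation path := (conn_path theta D).

Lemma aff_connE (c : R) a mu t x :
  aff (c, a) mu (t, x) = c *: dslice mu t x + path t a (slice mu t) x.
Proof.
rewrite /aff_conn /=; congr (_ + _); rewrite /conn_add /conn_path; vect_ring.
Qed.

Lemma conn_path0 t (s : section E) x : Gamma s -> path t (fun=> 0) s x = 0.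
Proof.
by move=> ss; rewrite /conn_path conn0// form1_0// zero_lfunE scaler0 addr0.
Qed.

Lemma slice_aff_conn a mu t : slice (aff (0, a) mu) t = path t a (slice mu t).
Proof.
by apply: eq_section => x; rewrite /slice aff_connE scale0r add0r.
Qed.

Lemma slice_aff_conn_dt mu t : Gamma mu ->
  slice (aff (1, fun=> 0) mu) t = dslice mu t.
Proof.
move=> smu; apply: eq_section => x; rewrite /slice aff_connE scale1r conn_path0.
  by rewrite addr0.
exact: Gamma_slice.
Qed.

(** The product rule for D_a mu_s + s theta(a) mu_s leaves theta(a) mu_t, from the derivative of the
    factor s; all else is nabla^t_a applied to the derivative of mu and cancels. *)
Lemma curvature_aff_conn_dt a mu t x : Gamma a -> Gamma mu ->
  curvature abr aff (1, fun=> 0) (0, a) mu (t, x) =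
  theta (fun=> a) x (slice mu t x).
Proof.
move=> sa smu; rewrite /curvature.
have ss := Gamma_slice t smu; have sds := Gamma_dslice t smu.
have -> : abr (1, fun=> 0) (0, a) = (0, fun=> 0).
  by congr (_, _); apply: eq_section => y; exact: bracket0l.
rewrite !aff_connE !slice_aff_conn slice_aff_conn_dt//.
rewrite !conn_path0//; last exact: conn_path_smooth.
have -> : dslice (aff (0, a) mu) t x =
    D a (dslice mu t) x + (1 *: theta (fun=> a) x (slice mu t x) +
                          t *: theta (fun=> a) x (dslice mu t x)).
  apply: is_fibre_deriveE.
  rewrite (_ : (fun s => _) = fun s : R => D a (slice mu s) x +
      s *: theta (fun=> a) x (slice mu s x)); last first.
    by apply/funext => s; rewrite slice_aff_conn.
  apply: is_fibre_deriveD; first exact: is_fibre_derive_conn.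
  have did : is_derive t 1 (fun s : R => s) 1 by exact: is_derive_id.
  apply: is_fibre_deriveZ did _.
  by apply: is_fibre_derive_lfun; exact: is_fibre_derive_slice.
rewrite /conn_path; vect_ring.
Qed.

(** [curvature_antisym] is about connections of a Lie algebroid, whereas [aff] is indexed by
    [aff_section]. Here both brackets are zero, and the operators vanish on them. *)
Lemma curvature_aff_conn_dtr a mu t x : Gamma a -> Gamma mu ->
  curvature abr aff (0, a) (1, fun=> 0) mu (t, x) =
  - theta (fun=> a) x (slice mu t x).
Proof.
move=> sa smu; rewrite -curvature_aff_conn_dt// /curvature.
have ss := Gamma_slice t smu.
have -> : abr (1, fun=> 0) (0, a) = (0, fun=> 0).
  by congr (_, _); apply: eq_section => y; exact: bracket0l.
have -> : abr (0, a) (1, fun=> 0) = (0, fun=> 0).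
  congr (_, _); apply: eq_section => y.
  exact: op_linear0 (bracket_op_linear sa) y.
rewrite !aff_connE !slice_aff_conn slice_aff_conn_dt//.
rewrite !conn_path0//; last exact: conn_path_smooth.
vect_ring.
Qed.

Lemma curvature_aff_conn a b mu t x : Gamma mu ->
  curvature abr aff (0, a) (0, b) mu (t, x) =
  curvature br (path t) a b (slice mu t) x.
Proof.
move=> smu.
by rewrite /curvature !aff_connE !slice_aff_conn !scale0r !add0r.
Qed.

(** [endo_ofE] is stated over manifolds modelled on row vectors, and R x M is modelled on a product.
    Uniqueness comes from sections constant in t, which take every value at (t, x). *)
Lemma pullback_endo_of (P : section (pullback_line E) -> section (pullback_line E))
    t x (T : 'End(E x)) :
  (forall mu, Gamma mu -> P mu (t, x) = T (slice mu t x)) ->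
  endo_of P (t, x) = T.
Proof.
move=> PT; rewrite /endo_of; case: xgetP => [T' _ T'P|/(_ T)]//.
apply/lfunP => u; have [mu smu <-] := @pullback_extend _ _ _ E (t, x) u.
by rewrite -T'P// PT.
Qed.

Definition aff_curvature t x a b : 'End(E x) :=
  endo_of (curvature br D a b) x +
  t *: d_End D theta (fun j => if j == ord0 then a else b) x +
  (t * t) *: comm_lfun (theta (fun=> a) x) (theta (fun=> b) x).

Lemma endo_aff_conn_dt a t x : Gamma a ->
  endo_of (curvature abr aff (1, fun=> 0) (0, a)) (t, x) = theta (fun=> a) x.
Proof.
move=> sa; apply: pullback_endo_of => mu smu.
exact: curvature_aff_conn_dt.
Qed.

Lemma endo_aff_conn_dtr a t x : Gamma a ->
  endo_of (curvature abr aff (0, a) (1, fun=> 0)) (t, x) = - theta (fun=> a) x.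
Proof.
move=> sa; apply: pullback_endo_of => mu smu.
by rewrite curvature_aff_conn_dtr// opp_lfunE.
Qed.

Lemma endo_aff_conn a b t x : Gamma a -> Gamma b ->
  endo_of (curvature abr aff (0, a) (0, b)) (t, x) = aff_curvature t x a b.
Proof.
move=> sa sb; apply: pullback_endo_of => mu smu.
rewrite curvature_aff_conn// (curvature_conn_path atheta cD)//.
exact: Gamma_slice.
Qed.

Lemma endo_curvature_antisym a b x : Gamma a -> Gamma b ->
  endo_of (curvature br D b a) x = - endo_of (curvature br D a b) x.
Proof.
move=> sa sb; apply: endo_ofE => s ss.
by rewrite (curvature_antisym cD)// opp_lfunE -(curvature_endo cD).
Qed.

Lemma d_End_antisym a b x : Gamma a -> Gamma b ->
  d_End D theta (fun j => if j == ord0 then b else a) x =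
  - d_End D theta (fun j => if j == ord0 then a else b) x.
Proof.
move=> sa sb; rewrite /d_End /=.
have -> : theta (fun=> bracket b a) x = - theta (fun=> bracket a b) x.
  rewrite -form1N//; last exact: bracket_smooth.
  congr (theta _ x); apply/funext => _; apply: eq_section => y.
  exact: bracket_antisym.
have zE (Z : zmodType) (p q r : Z) : q - p - - r = - (p - q - r).
  by rewrite !opprB opprK addrC.
exact: zE.
Qed.

Lemma aff_curvature_antisym t x a b : Gamma a -> Gamma b ->
  aff_curvature t x b a = - aff_curvature t x a b.
Proof.
move=> sa sb; rewrite /aff_curvature endo_curvature_antisym// d_End_antisym//.
have zE (Z : lmodType R) (k l : R) (r d p q : Z) :
    - r + k *: - d + l *: (q - p) = - (r + k *: d + l *: (p - q)).
  by rewrite -(opprB p q) !scalerN !opprD.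
exact: zE.
Qed.

End affine_combination.

(** * Permutation sums and traces *)

(* The summands below take the values of a permutation as natural numbers, so
   that the indices produced by the recursion on lift_perm compute. *)
Section alternating_sums.
Context (R : comNzRingType).
Implicit Types (Z : lmodType R).
Local Notation o n k := (@Ordinal n k isT).

(** Like the expansion of a determinant along a row: a permutation is its value j at 0, with sign
    (-1)^j, and a permutation of the rest. Injectivity and (n+1)! = (n+1) n! give the bijection. *)
Lemma sum_perm_rec Z n (F : 'S_n.+1 -> Z) :
  \sum_(t : 'S_n.+1) (-1) ^+ t *: F t =
  \sum_(j < n.+1) (-1) ^+ j *:
    \sum_(s : 'S_n) (-1) ^+ s *: F (lift_perm ord0 j s).
Proof.
under [RHS]eq_bigr do rewrite scaler_sumr; rewrite pair_big /=.
pose h (p : 'I_n.+1 * 'S_n) := lift_perm ord0 p.1 p.2.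
have h_inj : injective h.
  move=> [j s] [j' s'] /permP hE; have := hE ord0; rewrite !lift_perm_id /= => jE.
  subst j'; congr (_, _); apply/permP => k.
  by have := hE (lift ord0 k); rewrite !lift_perm_lift => /lift_inj.
rewrite (reindex h); last first.
  apply: onW_bij; apply: inj_card_bij h_inj _.
  by rewrite card_prod card_ord !card_Sn factS.
apply: eq_bigr => -[j s] _; rewrite /h /= scalerA; congr (_ *: _).
by rewrite odd_lift_perm /= -(signr_odd _ j) -signr_addb.
Qed.

Lemma sum_perm0 Z (F : 'S_0 -> Z) : \sum_(t : 'S_0) (-1) ^+ t *: F t = F 1%g.
Proof.
rewrite (big_pred1 1%g); first by rewrite odd_perm1 scale1r.
by move=> t; rewrite /=; apply/esym/eqP/permP => -[].
Qed.

Lemma sum_perm1 Z (G : nat -> Z) :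
  \sum_(t : 'S_1) (-1) ^+ t *: G (t (o 1 0)) = G 0%N.
Proof.
rewrite sum_perm_rec big_ord1 sum_perm0 scale1r.
by rewrite (_ : o 1 0 = ord0) ?lift_perm_id//; exact: val_inj.
Qed.

Lemma sum_perm2 Z (G : nat -> nat -> Z) :
  \sum_(t : 'S_2) (-1) ^+ t *: G (t (o 2 0)) (t (o 2 1)) = G 0%N 1%N - G 1%N 0%N.
Proof.
rewrite sum_perm_rec.
have -> : o 2 0 = ord0 :> 'I_2 by exact: val_inj.
have -> : o 2 1 = lift ord0 (o 1 0) :> 'I_2 by exact: val_inj.
under eq_bigr => j _.
  under eq_bigr do rewrite lift_perm_id lift_perm_lift.
  (* [bump j] is [lift j] on the underlying natural numbers. *)
  rewrite (sum_perm1 (fun k => G j (bump j k))); over.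
rewrite !big_ord_recl big_ord0.
change ((-1) ^+ 0 *: G 0%N 1%N + ((-1) ^+ 1 *: G 1%N 0%N + 0) = G 0%N 1%N - G 1%N 0%N).
by rewrite expr0 expr1 scale1r scaleN1r addr0.
Qed.

Lemma sum_perm3 Z (G : nat -> nat -> nat -> Z) :
  \sum_(t : 'S_3) (-1) ^+ t *: G (t (o 3 0)) (t (o 3 1)) (t (o 3 2)) =
  (G 0%N 1%N 2%N - G 0%N 2%N 1%N) - (G 1%N 0%N 2%N - G 1%N 2%N 0%N)
  + (G 2%N 0%N 1%N - G 2%N 1%N 0%N).
Proof.
rewrite sum_perm_rec.
have -> : o 3 0 = ord0 :> 'I_3 by exact: val_inj.
have -> : o 3 1 = lift ord0 (o 2 0) :> 'I_3 by exact: val_inj.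
have -> : o 3 2 = lift ord0 (o 2 1) :> 'I_3 by exact: val_inj.
under eq_bigr => j _.
  under eq_bigr do rewrite lift_perm_id !lift_perm_lift.
  rewrite (sum_perm2 (fun k l => G j (bump j k) (bump j l))); over.
rewrite !big_ord_recl big_ord0.
change ((-1) ^+ 0 *: (G 0%N 1%N 2%N - G 0%N 2%N 1%N) +
  ((-1) ^+ 1 *: (G 1%N 0%N 2%N - G 1%N 2%N 0%N) +
  ((-1) ^+ 2 *: (G 2%N 0%N 1%N - G 2%N 1%N 0%N) + 0)) =
  (G 0%N 1%N 2%N - G 0%N 2%N 1%N) - (G 1%N 0%N 2%N - G 1%N 2%N 0%N)
  + (G 2%N 0%N 1%N - G 2%N 1%N 0%N)).
by rewrite expr0 expr1 sqrrN expr1n !scale1r scaleN1r addr0 addrA.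
Qed.

Lemma sum_perm4 Z (G : nat -> nat -> nat -> nat -> Z) :
  let S a b c d := (G a b c d - G a b d c) - (G a c b d - G a c d b)
                   + (G a d b c - G a d c b) in
  \sum_(t : 'S_4) (-1) ^+ t *: G (t (o 4 0)) (t (o 4 1)) (t (o 4 2)) (t (o 4 3)) =
  S 0%N 1%N 2%N 3%N - S 1%N 0%N 2%N 3%N + S 2%N 0%N 1%N 3%N - S 3%N 0%N 1%N 2%N.
Proof.
move=> S; rewrite sum_perm_rec.
have -> : o 4 0 = ord0 :> 'I_4 by exact: val_inj.
have -> : o 4 1 = lift ord0 (o 3 0) :> 'I_4 by exact: val_inj.
have -> : o 4 2 = lift ord0 (o 3 1) :> 'I_4 by exact: val_inj.
have -> : o 4 3 = lift ord0 (o 3 2) :> 'I_4 by exact: val_inj.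
under eq_bigr => j _.
  under eq_bigr do rewrite lift_perm_id !lift_perm_lift.
  rewrite (sum_perm3 (fun k l m => G j (bump j k) (bump j l) (bump j m))); over.
rewrite !big_ord_recl big_ord0.
change ((-1) ^+ 0 *: S 0%N 1%N 2%N 3%N + ((-1) ^+ 1 *: S 1%N 0%N 2%N 3%N +
  ((-1) ^+ 2 *: S 2%N 0%N 1%N 3%N + ((-1) ^+ 3 *: S 3%N 0%N 1%N 2%N + 0))) =
  S 0%N 1%N 2%N 3%N - S 1%N 0%N 2%N 3%N + S 2%N 0%N 1%N 3%N - S 3%N 0%N 1%N 2%N).
by rewrite expr0 expr1 [(-1) ^+ 3]exprS sqrrN expr1n mulr1 !scale1r !scaleN1r
  addr0 !addrA.
Qed.

End alternating_sums.

Section traces.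
Context (R : realType) (F : vectType R).
Implicit Types (f g : 'End(F)).

Lemma fibre_traceD f g : fibre_trace (f + g) = fibre_trace f + fibre_trace g.
Proof.
by rewrite /fibre_trace -big_split; apply: eq_bigr => i _; rewrite add_lfunE coordD.
Qed.

Lemma fibre_traceZ (c : R) f : fibre_trace (c *: f) = c * fibre_trace f.
Proof.
rewrite /fibre_trace mulr_sumr; apply: eq_bigr => i _.
by rewrite scale_lfunE coordZ.
Qed.

Lemma fibre_traceN f : fibre_trace (- f) = - fibre_trace f.
Proof. by rewrite -scaleN1r fibre_traceZ mulN1r. Qed.

Lemma fibre_trace_comp f g : fibre_trace (f \o g)%VF = fibre_trace (g \o f)%VF.
Proof.
pose b := vbasis {:F}.
have E (f1 f2 : 'End(F)) : fibre_trace (f1 \o f2)%VF =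
    \sum_i \sum_(j < \dim {:F}) coord b i (f1 b`_j) * coord b j (f2 b`_i).
  apply: eq_bigr => i _; rewrite comp_lfunE (tnth_nth 0).
  rewrite {1}(coord_vbasis (memvf (f2 _))) !linear_sum.
  by apply: eq_bigr => j _; rewrite /= lfunZ coordZ mulrC.
rewrite !E exchange_big; apply: eq_bigr => i _; apply: eq_bigr => j _.
by rewrite mulrC.
Qed.

End traces.

Lemma Rintegral_quadratic (R : realType) (c0 c1 c2 : R) :
  \int[lebesgue_measure]_(t in `[0, 1]%classic) (c0 + c1 * t + c2 * (t * t)) =
  c0 + c1 / 2 + c2 / 3.
Proof.
pose P : {poly R} := c0 *: 'X + (c1 / 2) *: 'X^2 + (c2 / 3) *: 'X^3.
have dP : horner P^`() = fun t => c0 + c1 * t + c2 * (t * t).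
  apply/funext => t; rewrite /P !poly.derivE. rewrite !hornerE /=.
  by field.
have := @continuous_FTC2 R (horner P^`()) (horner P) 0 1 ltr01.
rewrite -dP /Rintegral => -> //.
- rewrite /P /= !hornerE /=; field.
- by [].
- by apply: continuous_subspaceT => t; exact: continuous_horner.
- split=> [t _||]; first exact: derivable_horner.
  + exact/cvg_at_right_filter/continuous_horner.
  + exact/cvg_at_left_filter/continuous_horner.
- by move=> t _; rewrite derivE.
Qed.

Section trace_identities.
Context (R : realType) (F : vectType R).
Implicit Types (K : nat -> nat -> 'End(F)) (T : nat -> 'End(F)).
Local Notation tr := (@fibre_trace R F).
Local Notation o n k := (@Ordinal n k isT).

(** The 24 permutations fall into 3 splittings of the indices into two pairs, 8 for each.
    Antisymmetry inside the pairs accounts for 4, cancelled by the normalization; exchanging the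
    pairs under the trace leaves the factor 2. *)
Lemma trace_sum_perm4 K :
  (forall k l, (k < l < 4)%N -> K l k = - K k l) ->
  tr ((2 ^+ 2)^-1 *: \sum_(t : 'S_4) (-1) ^+ t *:
    (K (t (o 4 0)) (t (o 4 1)) \o K (t (o 4 2)) (t (o 4 3)))%VF) =
  2 * (tr (K 0%N 1%N \o K 2%N 3%N)%VF - tr (K 0%N 2%N \o K 1%N 3%N)%VF +
       tr (K 0%N 3%N \o K 1%N 2%N)%VF).
Proof.
move=> aK; rewrite (sum_perm4 (fun a b c d => (K a b \o K c d)%VF)).
rewrite !(aK 0%N 1%N, aK 0%N 2%N, aK 0%N 3%N, aK 1%N 2%N, aK 1%N 3%N, aK 2%N 3%N)//.
rewrite !(comp_lfunNl, comp_lfunNr) fibre_traceZ !(fibre_traceD, fibre_traceN).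
rewrite (fibre_trace_comp (K 1%N 2%N)) (fibre_trace_comp (K 1%N 3%N)).
rewrite (fibre_trace_comp (K 2%N 3%N)).
by field.
Qed.

(* The trace of T /\ H for a 2-form H with values H k l on the k-th and l-th
   of three arguments. *)
Definition trace_wedge T K : R :=
  tr (T 0%N \o K 1%N 2%N)%VF - tr (T 1%N \o K 0%N 2%N)%VF + tr (T 2%N \o K 0%N 1%N)%VF.

Lemma trace_sum_perm3 T K :
  (forall k l, (k < l < 3)%N -> K l k = - K k l) ->
  tr ((1`!%:R * 2`!%:R)^-1 *: \sum_(t : 'S_3) (-1) ^+ t *:
    (T (t (o 3 0)) \o K (t (o 3 1)) (t (o 3 2)))%VF) = trace_wedge T K.
Proof.
move=> aK; rewrite (sum_perm3 (fun a b c => (T a \o K b c)%VF)).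
rewrite !(aK 0%N 1%N, aK 0%N 2%N, aK 1%N 2%N)//.
rewrite !comp_lfunNr fibre_traceZ !(fibre_traceD, fibre_traceN) /trace_wedge.
rewrite !factS fact0 !muln1; by field.
Qed.

Lemma trace_wedge_lin T K0 K1 K2 (t : R) :
  trace_wedge T (fun k l => K0 k l + t *: K1 k l + (t * t) *: K2 k l) =
  trace_wedge T K0 + trace_wedge T K1 * t + trace_wedge T K2 * (t * t).
Proof.
rewrite /trace_wedge !comp_lfunDr -!comp_lfunZr !(fibre_traceD, fibre_traceZ).
ring.
Qed.

Lemma trace_wedgeN T K :
  trace_wedge T (fun k l => - K k l) = - trace_wedge T K.
Proof.
by rewrite /trace_wedge !comp_lfunNr !fibre_traceN !opprD !opprK.
Qed.

Lemma trace_wedge0 T : trace_wedge T (fun _ _ => 0) = 0.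
Proof.
have t0 : tr 0 = 0 by rewrite -(scale0r 0) fibre_traceZ mul0r.
by rewrite /trace_wedge !comp_lfun0r !t0 subrr addr0.
Qed.

(** The commutator is the value of theta /\ theta on two arguments; cyclicity moves it to the right
    of the third factor. Both sides are 3 (tr(T0 T1 T2) - tr(T0 T2 T1)). *)
Lemma trace_cube T :
  tr ((2`!%:R * 1`!%:R)^-1 *: \sum_(t : 'S_3) (-1) ^+ t *:
    (((T (t (o 3 0)) \o T (t (o 3 1))) - (T (t (o 3 1)) \o T (t (o 3 0))))
      \o T (t (o 3 2)))%VF) =
  trace_wedge T (fun k l => comm_lfun (T k) (T l)).
Proof.
rewrite (sum_perm3 (fun a b c => (((T a \o T b) - (T b \o T a)) \o T c)%VF)).
rewrite /trace_wedge /comm_lfun.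
rewrite !(comp_lfunDl, comp_lfunDr, comp_lfunNl, comp_lfunNr, opprD, opprK).
rewrite fibre_traceZ !(fibre_traceD, fibre_traceN).
have cyc a b c : tr ((T a \o T b) \o T c)%VF = tr (T c \o (T a \o T b))%VF.
  exact: fibre_trace_comp.
have rot a b c : tr (T a \o (T b \o T c))%VF = tr (T b \o (T c \o T a))%VF.
  by rewrite fibre_trace_comp comp_lfunA.
(* Every cyclic word is rotated until it starts with [T 0]. *)
rewrite !cyc !(rot 1%N 2%N 0%N) !(rot 2%N 0%N 1%N)
  !(rot 2%N 1%N 0%N) !(rot 1%N 0%N 2%N).
rewrite !factS fact0 !muln1; by field.
Qed.

End trace_identities.

(** * The forms cs_1 and cs_2 *)

Section chern_simons_forms.
Context (R : realType) (n : nat) (M : manifold 'rV[R]_n).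
Context (A : lie_algebroid M) (E : vbundle M).
Variables (D : section A -> section E -> section E) (theta : End_form A E 1).
Hypotheses (cD : connection D) (atheta : alt_form theta).
Local Notation br := (@bracket _ _ _ A).
Local Notation abr := (@aff_bracket _ _ _ A).
Local Notation aff := (aff_conn D (conn_add D theta)).
Local Notation o n k := (@Ordinal n k isT).

Lemma chern_simons1 (a : section A) x : Gamma a ->
  chern_simons (p := 1) D (conn_add D theta) (fun=> a) x =
  fibre_trace (theta (fun=> a) x).
Proof.
move=> sa; rewrite /chern_simons.
(* The integrand is constant in t; the two zero terms give it the shape of [Rintegral_quadratic]. *)
have E1 (t : R) : chern abr aff (p := 1)
    (cons_args (1, fun=> 0) (fun i => (0, a))) (t, x) =
    fibre_trace (theta (fun=> a) x) + 0 * t + 0 * (t * t).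
  rewrite !mul0r !addr0 /chern; set u : aff_section A := (1, fun=> 0).
  pose v : aff_section A := (0, a).
  pose K k l := endo_of (curvature abr aff (nth u [:: u; v] k) (nth u [:: u; v] l)) (t, x).
  have -> : cons_args u (fun i => v) = fun j : 'I_2 => nth u [:: u; v] j.
    apply/funext => j; rewrite /cons_args.
    by case: (unliftP ord0 j) => [k ->|->] //=; rewrite (ord1 k).
  rewrite (_ : \sum_(t0 : 'S_1.*2) _ = K 0%N 1%N - K 1%N 0%N); last first.
    rewrite -(sum_perm2 K); apply: eq_bigr => s _; congr (_ *: _).
    rewrite big_ord_recl big_ord0 comp_lfun1r /K.
    rewrite (_ : pair_idx ord0 false = (o 2 0 : 'I_1.*2)); last exact: val_inj.
    by rewrite (_ : pair_idx ord0 true = (o 2 1 : 'I_1.*2))//; exact: val_inj.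
  rewrite /K /= endo_aff_conn_dt// endo_aff_conn_dtr// opprK.
  rewrite fibre_traceZ fibre_traceD; have half (q : R) : (2 ^+ 1)^-1 * (q + q) = q.
    by field.
  exact: half.
under eq_Rintegral do rewrite E1.
by rewrite Rintegral_quadratic !mul0r !addr0.
Qed.

Section three_sections.
Variables (a : 'I_3 -> section A) (x : M).
Hypothesis sa : forall i, Gamma (a i).

(** The permutation sums take natural numbers as indices; padding with the zero section, which is
    smooth, keeps [sb] true for every k. *)
Let b (k : nat) : section A := nth (fun=> 0) [:: a (o 3 0); a (o 3 1); a (o 3 2)] k.

Let bE : a = fun i => b i.
Proof.
apply/funext => -[[|[|[|i]]] hi] //; rewrite /b /=; congr a; exact: val_inj.
Qed.

Let sb k : Gamma (b k).
Proof.
case: k => [|[|[|k]]]; rewrite /b /=; try exact: sa.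
by rewrite nth_nil; exact: Gamma0.
Qed.

Let T k : 'End(E x) := theta (fun=> b k) x.
Let Rk k l : 'End(E x) := endo_of (curvature br D (b k) (b l)) x.
Let dT k l : 'End(E x) := d_End D theta (fun j => if j == ord0 then b k else b l) x.
Let CT k l : 'End(E x) := comm_lfun (T k) (T l).

(** With d/dt as argument 0, the three splittings of [trace_sum_perm4] are the three terms of
    [trace_wedge] for theta and the curvature of nabla^t. *)
Lemma chern_simons2_trace_wedge :
  chern_simons (p := 2) D (conn_add D theta) a x =
  2 * trace_wedge T Rk + trace_wedge T dT + 2 / 3 * trace_wedge T CT.
Proof.
rewrite /chern_simons.
have E1 (t : R) : chern abr aff (p := 2)
    (cons_args (n := 4) (1, fun=> 0) (fun i : 'I_3 => (0, a i))) (t, x) =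
    2 * trace_wedge T Rk + (2 * trace_wedge T dT) * t +
    (2 * trace_wedge T CT) * (t * t).
  rewrite /chern; set u : aff_section A := (1, fun=> 0).
  pose B k : aff_section A := if k is k'.+1 then (0, b k') else u.
  have -> : cons_args (n := 4) u (fun i : 'I_3 => (0, a i)) = fun j : 'I_4 => B j.
    apply/funext => j; rewrite /cons_args.
    by case: (unliftP ord0 j) => [k ->|->] //=; rewrite bE.
  pose K k l : 'End(E x) := endo_of (curvature abr aff (B k) (B l)) (t, x).
  have K0 k : K 0%N k.+1 = T k by exact: endo_aff_conn_dt.
  have K0r k : K k.+1 0%N = - T k by exact: endo_aff_conn_dtr.
  have KS k l : K k.+1 l.+1 = Rk k l + t *: dT k l + (t * t) *: CT k l.
    exact: endo_aff_conn.
  rewrite (_ : \sum_(t0 : 'S_2.*2) _ = \sum_(s : 'S_4) (-1) ^+ s *: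
      (K (s (o 4 0)) (s (o 4 1)) \o K (s (o 4 2)) (s (o 4 3)))%VF); last first.
    apply: eq_bigr => s _; congr (_ *: _).
    rewrite !big_ord_recl big_ord0 comp_lfun1r /K.
    rewrite (_ : pair_idx ord0 false = (o 4 0 : 'I_2.*2)); last exact: val_inj.
    rewrite (_ : pair_idx ord0 true = (o 4 1 : 'I_2.*2)); last exact: val_inj.
    rewrite (_ : pair_idx (lift ord0 ord0) false = (o 4 2 : 'I_2.*2));
      last exact: val_inj.
    by rewrite (_ : pair_idx (lift ord0 ord0) true = (o 4 3 : 'I_2.*2))//;
      exact: val_inj.
  rewrite trace_sum_perm4; last first.
    (* Index 0 is d/dt, to which [aff_curvature] does not apply, so it is treated apart. *)
    move=> [|k] [|l] //; first by rewrite K0 K0r.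
    by move=> _; rewrite !KS; exact: (aff_curvature_antisym cD).
  rewrite !K0 !KS.
  have := trace_wedge_lin T Rk dT CT t; rewrite {1}/trace_wedge => ->.
  ring.
under eq_Rintegral do rewrite E1.
rewrite Rintegral_quadratic; by field.
Qed.

Lemma trace_End_wedge (h : End_form A E 2) (H : nat -> nat -> 'End(E x)) :
  (forall t : 'S_3, h (fun j => a (t (rshift 1 j))) x = H (t (o 3 1)) (t (o 3 2))) ->
  (forall k l, (k < l < 3)%N -> H l k = - H k l) ->
  fibre_trace (End_wedge theta h a x) = trace_wedge T H.
Proof.
move=> hH aH; rewrite -trace_sum_perm3// /End_wedge; congr (fibre_trace (_ *: _)).
apply: eq_bigr => s _; congr (_ *: (_ \o _)%VF); last exact: hH.
rewrite /T; congr (theta _ x); apply/funext => i; rewrite {1}bE (ord1 i).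
by congr (b (s _)); exact: val_inj.
Qed.

Lemma trace_wedge_curvature :
  fibre_trace (End_wedge theta (curvature_form br D) a x) = trace_wedge T Rk.
Proof.
apply: trace_End_wedge => [t|k l _]; last exact: endo_curvature_antisym.
rewrite /curvature_form {1 2}bE /Rk.
rewrite (_ : rshift 1 ord0 = o 3 1); last exact: val_inj.
by rewrite (_ : rshift 1 ord_max = o 3 2)//; exact: val_inj.
Qed.

Lemma trace_wedge_d_End :
  fibre_trace (End_wedge theta (d_End D theta) a x) = trace_wedge T dT.
Proof.
apply: trace_End_wedge => [t|k l _]; last exact: d_End_antisym.
rewrite /dT /d_End /= bE.
rewrite (_ : rshift 1 ord0 = o 3 1); last exact: val_inj.
by rewrite (_ : rshift 1 ord_max = o 3 2)//; exact: val_inj.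
Qed.

Lemma trace_wedge_cube :
  fibre_trace (End_wedge (End_wedge theta theta) theta a x) = trace_wedge T CT.
Proof.
rewrite -trace_cube /End_wedge; congr (fibre_trace (_ *: _)).
apply: eq_bigr => s _; congr (_ *: (_ \o _)%VF); last first.
  rewrite /T; congr (theta _ x); apply/funext => i; rewrite {1}bE (ord1 i).
  by congr (b (s _)); exact: val_inj.
(* The inner sum over S_2 is evaluated for a fixed outer s; [c] lists the two arguments that s hands
   to theta /\ theta. Its normalization 1! 1! is 1. *)
pose i0 : 'I_3 := lshift 1 (o 2 0); pose i1 : 'I_3 := lshift 1 (o 2 1).
pose c k := nth (fun=> 0) [:: a (s i0); a (s i1)] k : section A.
have cE (j : 'I_2) : a (s (lshift 1 j)) = c j.
  by case: j => -[|[|j]] hj //; rewrite /c /=; congr (a (s _)); exact: val_inj.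
pose Tc k := theta (fun=> c k) x.
rewrite (_ : \sum_(t : 'S_2) _ = \sum_(t : 'S_2) (-1) ^+ t *:
    (Tc (t (o 2 0)) \o Tc (t (o 2 1)))%VF); last first.
  apply: eq_bigr => t _; congr (_ *: (_ \o _)%VF); rewrite /Tc;
    congr (theta _ x); apply/funext => i; rewrite cE (ord1 i);
    by congr (c (t _)); exact: val_inj.
rewrite (sum_perm2 (fun k l => (Tc k \o Tc l)%VF)) factS fact0 muln1 mulr1 invr1 scale1r.
rewrite /Tc /c /= /T !bE.
rewrite (_ : i0 = o 3 0); last exact: val_inj.
by rewrite (_ : i1 = o 3 1)//; exact: val_inj.
Qed.

Lemma chern_simons2 :
  chern_simons (p := 2) D (conn_add D theta) a x =
  fibre_trace
    (2 *: End_wedge theta (curvature_form br D) a x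
     + End_wedge theta (d_End D theta) a x
     + (2 / 3) *: End_wedge (End_wedge theta theta) theta a x).
Proof.
rewrite 2!fibre_traceD (fibre_traceZ 2) (fibre_traceZ (2 / 3)).
rewrite trace_wedge_curvature trace_wedge_d_End.
by rewrite trace_wedge_cube chern_simons2_trace_wedge.
Qed.

Lemma chern_simons2_flat : flat D -> flat (conn_add D theta) ->
  chern_simons (p := 2) D (conn_add D theta) a x =
  - (1 / 3) * fibre_trace (End_wedge (End_wedge theta theta) theta a x).
Proof.
move=> fD fDt; rewrite chern_simons2_trace_wedge trace_wedge_cube.
have R0 k l : Rk k l = 0.
  by apply: endo_ofE => s ss; rewrite zero_lfunE; exact: fD.
have path1 : conn_path theta D 1 = conn_add D theta.
  apply/funext => c; apply/funext => s; apply: eq_section => y.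
  by rewrite /conn_path scale1r.
have dE k l : dT k l = - CT k l.
  apply/eqP; rewrite -addr_eq0; apply/eqP/lfunP => u.
  (* Flatness is a statement on smooth sections, so the vector u is extended to one before the
     curvature at t = 1 is used. *)
  have [s ss <-] := Gamma_extend u.
  have := curvature_conn_path atheta cD 1 x (sb k) (sb l) ss.
  rewrite path1 fDt// mulr1 !scale1r -/(Rk k l) R0 add0r zero_lfunE => H.
  exact: esym H.
have -> : Rk = fun _ _ => 0 by apply/funext => k; apply/funext => l.
have -> : dT = fun k l => - CT k l by apply/funext => k; apply/funext => l.
rewrite trace_wedge0 trace_wedgeN; by field.
Qed.

End three_sections.

End chern_simons_forms.

Unset Implicit Arguments.

Theorem mainTheorem7 (R : realType) (n : nat) (M : manifold 'rV[R]_n)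
    (A : lie_algebroid M) (E : vbundle M)
    (nabla : section A -> section E -> section E) (theta : End_form A E 1)
    (nablaP : connection nabla) (thetaP : alt_form theta) :
  [/\ connection (conn_add nabla theta),
      (forall (a : section A) (x : M), Gamma a ->
         chern_simons (p := 1) nabla (conn_add nabla theta) (fun=> a) x =
         fibre_trace (theta (fun=> a) x)),
      (forall (a : 'I_3 -> section A) (x : M), (forall i, Gamma (a i)) ->
         chern_simons (p := 2) nabla (conn_add nabla theta) a x =
         fibre_trace
           (2 *: End_wedge theta (curvature_form (@bracket _ _ _ A) nabla) a x
            + End_wedge theta (d_End nabla theta) a x
            + (2 / 3) *: End_wedge (End_wedge theta theta) theta a x)) &
      (flat nabla -> flat (conn_add nabla theta) ->
       forall (a : 'I_3 -> section A) (x : M), (forall i, Gamma (a i)) ->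
         chern_simons (p := 2) nabla (conn_add nabla theta) a x =
         - (1 / 3) * fibre_trace (End_wedge (End_wedge theta theta) theta a x))].
Proof.
split; first exact: connection_conn_add.
- by move=> a x; exact: chern_simons1.
- by move=> a x; exact: chern_simons2.
- by move=> fD fDt a x sa; exact: chern_simons2_flat.
Qed.
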